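(* Let $X$ be a symmetric Banach sequence lattice. Then there is a constant $C>0$ (independent of $n$) such that $$\inf_{m\le n}\Big(\frac{\varphi_{X'}(m-1)}{\varphi_{X'}(n)}\Big)^{\frac{m-1}m}\le C\,K(B_{X_n},\Lambda_T)\quad\text{for all }n,$$ and, for $1\le r\le 2$, there is a constant $C>0$ (independent of $n$) such that $$K(B_{X_n},\Lambda_T)\le C\frac{(\log n)^{1/r'}}{\varphi_{X'}(n)}\|\mathrm{id}:X_n\to\ell_r^n\|\quad\text{for all }n.$$
   Context: $X$ is a Banach space of complex sequences with the ideal property, symmetric meaning $\|(x_{\sigma(k)})\|=\|x\|$ for all permutations $\sigma$. $X_n$ is $\mathbb{C}^n$ with $\|z\|=\|\sum_{k\le n}|z_k|e_k\|_X$, $B_{X_n}$ its open unit ball. $X'$ is the Köthe dual and $\varphi_{X'}(k)=\|\sum_{j\le k}e_j\|_{X'}$. $r'$ is the conjugate exponent. $\Lambda_T$ is the set of all finitely supported multi-indices with entries in $\{0,1\}$. $K(B_{X_n},J)$ is the Bohr radius: the supremum of $r\in(0,1)$ with $\sup_{z\in rB_{X_n}}\sum_{\alpha\in J}|c_\alpha(f)z^\alpha|\le\sup_{B_{X_n}}|f|$ for all bounded holomorphic $f$ on $B_{X_n}$ with Taylor coefficients $c_\alpha(f)=\partial^\alpha f(0)/\alpha!$ vanishing outside $J$.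
   Formalization: The upper bound is stated for n ≥ 2, since at n = 1, r > 1 its right side is 0 while K(B_{X_1},Λ_T) = 1; bounded holomorphic f with coefficients supported in Λ_T are written as the polynomials Σ c_S z^S, which they equal by the identity theorem. *)

(* Defs.v *)
From HB Require Import structures.
From mathcomp Require Import all_boot all_order all_algebra.
From mathcomp Require Import all_classical all_reals all_analysis.
From mathcomp Require Import complex.
Set Implicit Arguments. Unset Strict Implicit. Unset Printing Implicit Defensive.
Import Order.TTheory GRing.Theory Num.Theory.
Local Open Scope classical_set_scope.
Local Open Scope ring_scope.

Section Defs.
Variable R : realType.

Definition cmod (z : R[i]) : R :=
  match z with Complex a b => Num.sqrt (a ^+ 2 + b ^+ 2) end.

Definition cseq := nat -> R[i].
Definition sadd (x y : cseq) : cseq := fun k => x k + y k.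
Definition ssub (x y : cseq) : cseq := fun k => x k - y k.
Definition sscale (a : R[i]) (x : cseq) : cseq := fun k => a * x k.
Definition szero : cseq := fun _ => 0.
Definition unit_seq (j : nat) : cseq := fun k => if k == j then 1 else 0.

(* A symmetric Banach sequence lattice: a set X of complex sequences with a
   function nrm which is a complete norm on X, with the ideal property,
   containing all e_j, and permutation invariant. Values of nrm outside X are
   irrelevant. *)
Definition symmetric_BSL (X : set cseq) (nrm : cseq -> R) : Prop :=
  [/\
      [/\ X szero,
      (forall x y, X x -> X y -> X (sadd x y)) &
      (forall a x, X x -> X (sscale a x))],
      [/\ (forall x, X x -> nrm x = 0 -> x = szero),
          (forall a x, X x -> nrm (sscale a x) = cmod a * nrm x) &
          (forall x y, X x -> X y -> nrm (sadd x y) <= nrm x + nrm y)],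
      (forall u : nat -> cseq, (forall p, X (u p)) ->
         (forall e : R, 0 < e -> exists N, forall p q, (N <= p)%N -> (N <= q)%N ->
              nrm (ssub (u p) (u q)) < e) ->
         exists x, X x /\ forall e : R, 0 < e -> exists N, forall p, (N <= p)%N ->
              nrm (ssub (u p) x) < e) &
      [/\ (forall x y, X x -> (forall k, cmod (y k) <= cmod (x k)) ->
             X y /\ nrm y <= nrm x),
          (forall j, X (unit_seq j)) &
          (forall (s : nat -> nat) x, bijective s -> X x ->
             X (x \o s) /\ nrm (x \o s) = nrm x)] ].

Definition kothe_norm (X : set cseq) (nrm : cseq -> R) (y : cseq) : \bar R :=
  ereal_sup [set (\sum_(0 <= k <oo) (cmod (x k * y k))%:E)%E
            | x in [set x | X x /\ nrm x <= 1]].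

Definition phi_dual (X : set cseq) (nrm : cseq -> R) (k : nat) : R :=
  fine (kothe_norm X nrm (fun j => if (j < k)%N then 1 else 0)).

Definition extend_abs (n : nat) (z : 'I_n -> R[i]) : cseq :=
  fun k => oapp (fun i : 'I_n => (cmod (z i))%:C%C) 0 (insub k).
Definition Xn_norm (nrm : cseq -> R) (n : nat) (z : 'I_n -> R[i]) : R :=
  nrm (extend_abs z).

Definition Xn_ball (nrm : cseq -> R) (n : nat) : set ('I_n -> R[i]) :=
  [set z | Xn_norm nrm z < 1].

(* Lambda_T in n variables: multi-indices with entries in {0,1}, i.e. subsets
   S of {0..n-1}; z^S = prod_{i in S} z_i. *)
Definition monom (n : nat) (S : {set 'I_n}) (z : 'I_n -> R[i]) : R[i] :=
  \prod_(i in S) z i.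

(* a (bounded holomorphic) function on B_{X_n} with Taylor coefficients
   supported in Lambda_T: f(z) = sum_S c_S z^S *)
Definition tetra (n : nat) (c : {set 'I_n} -> R[i]) (z : 'I_n -> R[i]) : R[i] :=
  \sum_(S : {set 'I_n}) c S * monom S z.

Definition bohr_ok (nrm : cseq -> R) (n : nat) (r : R) : Prop :=
  forall c : {set 'I_n} -> R[i],
    (ereal_sup [set (\sum_(S : {set 'I_n}) cmod (c S * monom S z)%R)%:E
              | z in [set (fun i => (r%:C%C * w i)%R) | w in @Xn_ball nrm n]]
    <= ereal_sup [set (cmod (tetra c z))%:E | z in @Xn_ball nrm n])%E.

Definition bohr_radius (nrm : cseq -> R) (n : nat) : R :=
  sup [set r : R | 0 < r < 1 /\ bohr_ok nrm n r].

Definition id_norm (nrm : cseq -> R) (n : nat) (r : R) : R :=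
  sup [set powR (\sum_(i < n) powR (cmod (z i)) r) r^-1
      | z in [set z | Xn_norm nrm z <= 1]].

End Defs.

(* Main.v *)
Require Import Defs.
From HB Require Import structures.
From mathcomp Require Import all_boot all_order all_algebra.
From mathcomp Require Import all_classical all_reals all_analysis.
From mathcomp Require Import complex ring lra zify.
Set Implicit Arguments. Unset Strict Implicit. Unset Printing Implicit Defensive.
Import Order.TTheory GRing.Theory Num.Theory.
Local Open Scope classical_set_scope.
Local Open Scope ring_scope.

(** Lower bound. If |f| <= M on the ball then every homogeneous part satisfies
    |P_m| <= 2 (M - |c_0|). For |J| = m - 1, evaluating P_m at half the sum of a
    multiple of 1_J and a vector supported off J, and averaging over signs on J,
    bounds the sum of |c_S z^(S \ J)| over S containing J by
    2^m phi_X(m-1)^(m-1) |P_m|. Summing over J against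
    e_(m-1)(|z|) <= (e phi_X'(n) / (m-1))^(m-1) and using phi_X(k) phi_X'(k) <= k,
    the sum of |c_S z^S| over |S| = m is at most
    2^m e^(m-1) (phi_X'(n) / phi_X'(m-1))^(m-1) |P_m|, so that the series
    converges geometrically at the radius inf_m (...) / (8 e).

    Upper bound. Take P to be the sum of eps_S z^S over |S| = m with random signs
    and m about log n. Since P is multiaffine, its supremum on a polydisc is
    attained at products of corners of squares, so its supremum on the l_r ball is
    controlled by finitely many points z, for which the sum of |z^S|^r is at most
    (C / m)^m; a Chernoff bound gives |P| <= n^8 (C / m)^(m/r) on the l_r ball. The
    factor n^8 disappears after taking m-th roots. Testing at a multiple of
    (1, ..., 1) and using binomial(n, m) >= (n / m)^m gives the bound on the
    radius. *)

(** * The modulus and Fourier coefficients of bounded polynomials *)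

Section Modulus.
Variable R : realType.
Implicit Types (z w : R[i]) (x : R).

Lemma cmodE z : (cmod z)%:C%C = `|z|.
Proof. by case: z => a b; rewrite normc_def. Qed.

Lemma cmod_ge0 z : 0 <= cmod z.
Proof. by case: z => a b; apply: sqrtr_ge0. Qed.

Lemma cmodM z w : cmod (z * w) = cmod z * cmod w.
Proof. by apply: complexI; rewrite rmorphM /= !cmodE normrM. Qed.

Lemma cmodN z : cmod (- z) = cmod z.
Proof. by apply: complexI; rewrite !cmodE normrN. Qed.

Lemma cmodD z w : cmod (z + w) <= cmod z + cmod w.
Proof. by rewrite -lecR rmorphD /= !cmodE ler_normD. Qed.

Lemma cmodB z w : cmod (z - w) <= cmod z + cmod w.
Proof. by rewrite -(cmodN w) cmodD. Qed.

Lemma cmod0 : cmod (0 : R[i]) = 0.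
Proof. by apply: complexI; rewrite cmodE normr0. Qed.

Lemma cmod1 : cmod (1 : R[i]) = 1.
Proof. by apply: complexI; rewrite cmodE normr1. Qed.

Lemma cmodR x : cmod (x%:C%C) = `|x|.
Proof. by rewrite /cmod /= expr0n /= addr0 sqrtr_sqr. Qed.

Lemma cmodRge0 x : 0 <= x -> cmod (x%:C%C) = x.
Proof. by move=> x0; rewrite cmodR ger0_norm. Qed.

Lemma cmod_cmod z : cmod ((cmod z)%:C%C) = cmod z.
Proof. by rewrite cmodRge0 ?cmod_ge0. Qed.

Lemma cmod_prod (I : Type) (s : seq I) (P : pred I) (F : I -> R[i]) :
  cmod (\prod_(i <- s | P i) F i) = \prod_(i <- s | P i) cmod (F i).
Proof. by apply: (big_morph (@cmod R) cmodM cmod1). Qed.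

Lemma sum_RC (I : Type) (s : seq I) (P : pred I) (F : I -> R) :
  \sum_(i <- s | P i) (F i)%:C%C = (\sum_(i <- s | P i) F i)%:C%C :> R[i].
Proof. by rewrite rmorph_sum. Qed.

Lemma exp_RC x k : x%:C%C ^+ k = (x ^+ k)%:C%C.
Proof. by rewrite rmorphXn. Qed.

Lemma Re_sum (I : Type) (s : seq I) (P : pred I) (F : I -> R[i]) :
  complex.Re (\sum_(i <- s | P i) F i) = \sum_(i <- s | P i) complex.Re (F i).
Proof. by apply: (big_morph (@complex.Re R)) => // -[? ?] [? ?]. Qed.

Lemma Im_sum (I : Type) (s : seq I) (P : pred I) (F : I -> R[i]) :
  complex.Im (\sum_(i <- s | P i) F i) = \sum_(i <- s | P i) complex.Im (F i).
Proof. by apply: (big_morph (@complex.Im R)) => // -[? ?] [? ?]. Qed.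

Lemma ler_Re_cmod z : `|complex.Re z| <= cmod z.
Proof. by rewrite -lecR cmodE normc_ge_Re. Qed.

Lemma ler_Im_cmod z : `|complex.Im z| <= cmod z.
Proof.
case: z => a b /=; rewrite -sqrtr_sqr ler_wsqrtr// lerDr; exact: sqr_ge0.
Qed.

Lemma cmod_le_ReIm z : cmod z <= `|complex.Re z| + `|complex.Im z|.
Proof.
case: z => a b /=; rewrite -[leRHS]ger0_norm ?addr_ge0// -[X in _ <= X]sqrtr_sqr.
rewrite ler_wsqrtr// sqrrD !real_normK ?num_real// addrAC lerDl.
by rewrite mulrn_wge0// mulr_ge0.
Qed.

Lemma phaseE z : exists2 u : R[i], cmod u = 1 & u * z = (cmod z)%:C%C.
Proof.
have [->|z0] := eqVneq z 0; first by exists 1; rewrite ?cmod1// cmod0 mulr0.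
exists ((cmod z)%:C%C / z); last by rewrite divfK.
apply: complexI; rewrite cmodE cmodE normrM normrV ?unitfE// normr_id mulfV//.
by rewrite normr_eq0.
Qed.

End Modulus.

(** * Coefficients of a polynomial bounded on the unit circle *)

Section FourierCoefficients.
Variable C : numClosedFieldType.
Implicit Types (w : C).

(** A [2 ^ k]-th root of -1 has order dividing [2 ^ k.+1] but not [2 ^ k]. Such roots of arbitrarily
    large order turn circle averages into finite sums. *)
Lemma two_power_primitive_root k : exists w : C, (2 ^ k.+1).-primitive_root w.
Proof.
pose w : C := (2 ^ k).-root (-1); exists w.
have wk : w ^+ (2 ^ k) = -1 by rewrite rootCK// expn_gt0.
have w1 : w ^+ (2 ^ k.+1) = 1 by rewrite expnSr exprM wk sqrrN expr1n.
have [d dw] := prim_order_exists (expn_gt0 2 k.+1) w1.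
case/(dvdn_pfactor _ _ (isT : prime 2)) => j; rewrite leq_eqVlt => /predU1P[-> <-//|].
rewrite ltnS => jk dE; have: w ^+ (2 ^ k) == 1.
  by rewrite -(prim_order_dvd dw) dE dvdn_exp2l.
by rewrite wk eq_sym -subr_eq0 opprK -(natrD _ 1 1) pnatr_eq0.
Qed.

Lemma sum_pow_root N w i : N.-primitive_root w -> ~~ (N %| i)%N ->
  \sum_(j < N) (w ^+ j) ^+ i = 0.
Proof.
move=> wN Ni; under eq_bigr do rewrite -exprM mulnC exprM.
have := subrX1 (w ^+ i) N; rewrite -exprM mulnC exprM (prim_expr_order wN) expr1n.
rewrite subrr => /esym/eqP; rewrite mulf_eq0 subr_eq0 -(prim_order_dvd wN).
by rewrite (negbTE Ni) => /eqP.
Qed.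

(* The function 2 M - g - g^* is nonnegative on the circle, so its Fourier
   coefficient of index m, namely - a m, is at most its mean. *)
Lemma coef_bound_nonneg (n m : nat) (a : nat -> C) (M : C) :
  (0 < m <= n)%N -> 0 <= a 0%N ->
  (forall w, `|w| = 1 -> `|\sum_(k < n.+1) a k * w ^+ k| <= M) ->
  `|a m| <= 2 * (M - a 0%N).
Proof.
move=> /andP[m0 mn] a0 gM.
have [w wN] := two_power_primitive_root n.+1.
set N := (2 ^ n.+2)%N in wN.
(* No aliasing modulo [N]: for k <= n the frequency m + k never vanishes, and N - m + k vanishes
   only for k = m. *)
have Nn : (n.*2.+1 < N)%N.
  rewrite /N !expnS -muln2.
  by have := ltn_expl n (isT : 1 < 2)%N; lia.
have N0 : (0 < N)%N by apply: leq_ltn_trans Nn.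
pose g x := \sum_(k < n.+1) a k * x ^+ k.
have wn j : `|w ^+ j| = 1.
  rewrite normrX; suff -> : `|w| = 1 by rewrite expr1n.
  apply/eqP; rewrite -(@pexpr_eq1 _ _ N)// -normrX.
  by rewrite (prim_expr_order wN) normr1.
pose H x := 2 * M - g x - (g x)^*.
have H0 j : 0 <= H (w ^+ j).
  rewrite /H -addrA -opprD subr_ge0 addrC.
  have -> : (g (w ^+ j))^* + g (w ^+ j) = 2 * 'Re (g (w ^+ j)).
    by rewrite ReE mulrCA mulfV ?mulr1 1?addrC// pnatr_eq0.
  rewrite ler_pM2l// (le_trans _ (gM _ (wn j)))//.
  by rewrite leif_Re_Creal.
have xN j : (w ^+ j) ^+ N = 1 by rewrite exprAC (prim_expr_order wN) expr1n.
have sum_g i : \sum_(j < N) (w ^+ j) ^+ i * g (w ^+ j) =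
    \sum_(k < n.+1) a k * (if (N %| i + k)%N then N%:R else 0).
  under eq_bigr do rewrite mulr_sumr.
  rewrite exchange_big; apply: eq_bigr => k _.
  under eq_bigr do rewrite mulrCA -exprD.
  rewrite -mulr_sumr; congr (_ * _); case: ifPn => [|/(sum_pow_root wN)//].
  move=> /dvdnP[q ->]; rewrite (eq_bigr (fun=> 1)) ?sumr_const ?card_ord// => j _.
  by rewrite mulnC exprM xN expr1n.
have Nnz : N%:R != 0 :> C by rewrite pnatr_eq0 -lt0n.
have S0 : \sum_(j < N) g (w ^+ j) = N%:R * a 0%N.
  transitivity (\sum_(j < N) (w ^+ j) ^+ 0 * g (w ^+ j)).
    by apply: eq_bigr => j _; rewrite expr0 mul1r.
  rewrite sum_g big_ord_recl dvdn0 mulrC big1 ?addr0// => k _.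
  rewrite gtnNdvd ?mulr0//= /bump /=; have := ltn_ord k; lia.
have Sm : \sum_(j < N) (w ^+ j) ^+ m * g (w ^+ j) = 0.
  rewrite sum_g big1// => k _.
  rewrite gtnNdvd ?mulr0//=; have := ltn_ord k; lia.
have SNm : \sum_(j < N) (w ^+ j) ^+ (N - m) * g (w ^+ j) = N%:R * a m.
  have mn1 : (m < n.+1)%N by [].
  rewrite sum_g (bigD1 (Ordinal mn1))//= subnK; last lia.
  rewrite dvdnn mulrC big1 ?addr0// => k; rewrite -val_eqE /= => km.
  case: ifP; rewrite ?mulr0// => /dvdnP[q].
  have := ltn_ord k; case: q => [|[|q]]; nia.
have conjx j : ((w ^+ j) ^+ (N - m))^* = (w ^+ j) ^+ m.
  have x0 : (w ^+ j) ^+ (N - m) != 0 by rewrite -normr_eq0 normrX wn expr1n oner_eq0.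
  apply: (mulfI x0); rewrite -normCK normrX wn !expr1n -exprD subnK ?xN//; lia.
have : `|\sum_(j < N) (w ^+ j) ^+ (N - m) * H (w ^+ j)| <= \sum_(j < N) H (w ^+ j).
  apply: le_trans (ler_norm_sum _ _ _) _; apply: ler_sum => j _.
  by rewrite normrM normrX wn expr1n mul1r ger0_norm.
have -> : \sum_(j < N) H (w ^+ j) = N%:R * (2 * (M - a 0%N)).
  rewrite !sumrB sumr_const card_ord -raddf_sum S0 /= rmorphM /= conjC_nat.
  by rewrite (geC0_conj a0) -mulr_natl; ring.
have -> : \sum_(j < N) (w ^+ j) ^+ (N - m) * H (w ^+ j) = - (N%:R * a m).
  transitivity (\sum_(j < N) ((w ^+ j) ^+ (N - m) * (2 * M)
      - (w ^+ j) ^+ (N - m) * g (w ^+ j)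
      - (w ^+ j) ^+ (N - m) * (g (w ^+ j))^*)).
    by apply: eq_bigr => j _; rewrite /H 2!mulrBr.
  rewrite !sumrB SNm -mulr_suml sum_pow_root ?mul0r; last first.
  - by rewrite gtnNdvd//; lia.
  - exact: wN.
  (* By [conjx] the conjugated term sums to the conjugate of the vanishing sum [Sm]. *)
  rewrite [X in _ - X](_ : _ = 0) ?subr0 ?sub0r//.
  rewrite -[RHS]conjC0 -[X in X^*]Sm rmorph_sum /=; apply: eq_bigr => j _.
  by rewrite rmorphM /= -conjx conjCK.
by rewrite normrN normrM normr_nat ler_pM2l// ltr0n.
Qed.

(** A unimodular factor [u] rotates [a 0] onto the nonnegative axis and changes no modulus. *)
Lemma coef_bound (n m : nat) (a : nat -> C) (M : C) :
  (0 < m <= n)%N ->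
  (forall w, `|w| = 1 -> `|\sum_(k < n.+1) a k * w ^+ k| <= M) ->
  `|a m| <= 2 * (M - `|a 0%N|).
Proof.
move=> mn gM.
pose u := if a 0%N == 0 then 1 else `|a 0%N| / a 0%N.
have u1 : `|u| = 1.
  rewrite /u; case: eqP => [|/eqP a0]; first by rewrite normr1.
  by rewrite normrM normrV ?unitfE// normr_id mulfV// normr_eq0.
have ua : u * a 0%N = `|a 0%N|.
  by rewrite /u; case: eqP => [->|/eqP a0]; rewrite ?mulr0 ?normr0// divfK.
have := @coef_bound_nonneg n m (fun k => u * a k) M mn.
rewrite ua normrM u1 mul1r; apply=> [|w w1]; first exact: normr_ge0.
under eq_bigr do rewrite -mulrA.
by rewrite -mulr_sumr normrM u1 mul1r; apply: gM.
Qed.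

End FourierCoefficients.

(** * Fundamental functions of a symmetric lattice and of its dual *)

Section SymmetricLattice.
Variables (R : realType) (X : set (cseq R)) (nrm : cseq R -> R).
Hypothesis XS : symmetric_BSL X nrm.
Implicit Types (x y : cseq R).

Lemma lattice_add x y : X x -> X y -> X (sadd x y).
Proof. by case: XS => -[_ H _] _ _ _; apply: H. Qed.

Lemma lattice_scale a x : X x -> X (sscale a x).
Proof. by case: XS => -[_ _ H] _ _ _; apply: H. Qed.

Lemma nrm_scale a x : X x -> nrm (sscale a x) = cmod a * nrm x.
Proof. by case: XS => _ [_ H _] _ _; apply: H. Qed.

Lemma nrm_add x y : X x -> X y -> nrm (sadd x y) <= nrm x + nrm y.
Proof. by case: XS => _ [_ _ H] _ _; apply: H. Qed.

Lemma nrm_ideal x y : X x -> (forall k, cmod (y k) <= cmod (x k)) ->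
  X y /\ nrm y <= nrm x.
Proof. by case: XS => _ _ _ [H _ _]; apply: H. Qed.

Lemma nrm_mono x y : X x -> (forall k, cmod (y k) <= cmod (x k)) ->
  nrm y <= nrm x.
Proof. by move=> Xx /(nrm_ideal Xx)[]. Qed.

Lemma lattice_unit j : X (unit_seq R j).
Proof. by case: XS => _ _ _ [_ H _]; apply: H. Qed.

Lemma nrm_perm (s : nat -> nat) x : bijective s -> X x ->
  X (x \o s) /\ nrm (x \o s) = nrm x.
Proof. by case: XS => _ _ _ [_ _ H]; apply: H. Qed.

Lemma nrm0 : nrm (szero R) = 0.
Proof.
have X0 : X (szero R) by case: XS => -[].
have -> : szero R = sscale 0 (szero R) by apply/funext => k; rewrite /sscale mul0r.
by rewrite nrm_scale// cmod0 mul0r.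
Qed.

Lemma nrm_eq_mod x y : X x -> (forall k, cmod (y k) = cmod (x k)) -> nrm y = nrm x.
Proof.
move=> Xx yx; have [Xy le] : X y /\ nrm y <= nrm x by apply: nrm_ideal => // k; rewrite yx.
by apply/le_anti; rewrite le nrm_mono// => k; rewrite yx.
Qed.

(** Positivity follows from the triangle inequality, since 0 = |x - x| <= 2 |x|. *)
Lemma nrm_ge0 x : X x -> 0 <= nrm x.
Proof.
move=> Xx; have := nrm_add Xx (lattice_scale (-1) Xx).
have -> : sadd x (sscale (-1) x) = szero R.
  by apply/funext => k; rewrite /sadd /sscale mulN1r subrr.
by rewrite nrm0 nrm_scale// cmodN cmod1 mul1r -mulr2n pmulrn_lge0.
Qed.

Lemma finite_support_lattice n x : (forall k, (n <= k)%N -> x k = 0) -> X x.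
Proof.
elim: n x => [|n IH] x x0.
  by rewrite (_ : x = szero R); [case: XS => -[]|apply/funext => k; rewrite x0].
rewrite (_ : x = sadd (fun k => if k == n then 0 else x k) (sscale (x n) (unit_seq R n))).
  apply: lattice_add; last exact/lattice_scale/lattice_unit.
  apply: IH => k nk; case: eqP => // /eqP kn; apply: x0; rewrite ltn_neqAle eq_sym kn//.
apply/funext => k; rewrite /sadd /sscale /unit_seq.
by case: eqP => [->|_]; rewrite ?mulr1 ?mulr0 ?add0r ?addr0.
Qed.

Lemma nrm_unit_gt0 j : 0 < nrm (unit_seq R j).
Proof.
rewrite lt_neqAle nrm_ge0 ?andbT; last exact: lattice_unit.
rewrite eq_sym; apply/eqP => e0.
case: XS => _ [H _ _] _ _; have /(congr1 (@^~ j)) := H _ (lattice_unit j) e0.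
by rewrite /unit_seq /szero eqxx => /eqP; rewrite oner_eq0.
Qed.

Lemma coord_le_nrm x j : X x -> cmod (x j) * nrm (unit_seq R j) <= nrm x.
Proof.
move=> Xx; rewrite -nrm_scale; last exact: lattice_unit.
apply: nrm_mono => // k; rewrite /sscale /unit_seq.
by case: eqP => [->|]; rewrite ?mulr1// mulr0 cmod0 cmod_ge0.
Qed.

Definition indic_seq (A : pred nat) : cseq R := fun k => (A k)%:R.

Lemma cmod_indic A k : cmod (indic_seq A k) = (A k)%:R.
Proof. by rewrite /indic_seq; case: (A k); rewrite ?cmod1 ?cmod0. Qed.

Lemma kothe_normE k :
  kothe_norm X nrm (fun j => if (j < k)%N then 1 else 0) =
  ereal_sup [set (\sum_(j < k) cmod (x j))%:E | x in [set x | X x /\ nrm x <= 1]].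
Proof.
rewrite /kothe_norm; congr ereal_sup; apply: eq_imagel => x _ /=.
rewrite (@nneseries_split _ _ 0 k) => [|j _]; last by rewrite lee_fin cmod_ge0.
rewrite add0n eseries0 => [|j kj _]; last by rewrite ltnNge kj mulr0 cmod0.
rewrite adde0 big_mkord sumEFin; congr (_%:E).
by apply: eq_bigr => j _; rewrite ltn_ord mulr1.
Qed.

(** Finiteness of the supremum ensures that [fine] in [phi_dual] loses nothing; each coordinate is
    controlled by the norm of its unit vector. *)
Lemma kothe_norm_bounds k :
  (0 <= kothe_norm X nrm (fun j => if (j < k)%N then 1%R else 0%R)
     <= (\sum_(j < k) (nrm (unit_seq R j))^-1)%:E)%E.
Proof.
rewrite kothe_normE; apply/andP; split.
  apply: ereal_sup_ubound; exists (szero R).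
    by rewrite /= nrm0; split=> //; case: XS => -[].
  by rewrite big1// => j _; rewrite cmod0.
apply: ge_ereal_sup => _ [x [Xx x1] <-]; rewrite lee_fin; apply: ler_sum => j _.
rewrite -[leRHS]mul1r ler_pdivlMr ?nrm_unit_gt0//.
exact: le_trans (coord_le_nrm _ Xx) x1.
Qed.

Lemma phi_dualE k : (phi_dual X nrm k)%:E =
  ereal_sup [set (\sum_(j < k) cmod (x j))%:E | x in [set x | X x /\ nrm x <= 1]].
Proof.
rewrite /phi_dual fineK; first exact: kothe_normE.
have /andP[l u] := kothe_norm_bounds k.
by rewrite fin_numElt (lt_le_trans _ l)// (le_lt_trans u)// ltry.
Qed.

Lemma phi_dual_ub k x : X x -> nrm x <= 1 -> \sum_(j < k) cmod (x j) <= phi_dual X nrm k.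
Proof.
by move=> Xx x1; rewrite -lee_fin phi_dualE; apply: ereal_sup_ubound; exists x.
Qed.

Lemma phi_dual_le k M :
  (forall x, X x -> nrm x <= 1 -> \sum_(j < k) cmod (x j) <= M) -> phi_dual X nrm k <= M.
Proof.
move=> H; rewrite -lee_fin phi_dualE; apply: ge_ereal_sup => _ [x [Xx x1] <-].
by rewrite lee_fin H.
Qed.

Lemma phi_dual_gt0 k : (0 < k)%N -> 0 < phi_dual X nrm k.
Proof.
case: k => // k _; pose a := (nrm (unit_seq R 0))^-1.
have a0 : 0 < a by rewrite invr_gt0 nrm_unit_gt0.
have X0 := lattice_unit 0.
have := @phi_dual_ub k.+1 (sscale a%:C%C (unit_seq R 0)) (lattice_scale _ X0).
rewrite nrm_scale// (cmodRge0 (ltW a0)) {1}/a mulVf ?gt_eqF ?nrm_unit_gt0// => /(_ (lexx _)).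
apply: lt_le_trans; rewrite big_ord_recl ltr_pwDl ?sumr_ge0// => [|i _].
  by rewrite /sscale /unit_seq eqxx mulr1 (cmodRge0 (ltW a0)).
exact: cmod_ge0.
Qed.

(* Averaging a vector over the cyclic shifts of its first k coordinates gives a
   multiple of the indicator. *)
Lemma nrm_average k x : X x -> nrm x <= 1 ->
  (\sum_(j < k) cmod (x j)) * nrm (indic_seq (fun j => (j < k)%N)) <= k%:R.
Proof.
case: k => [|k] Xx x1; first by rewrite big_ord0 mul0r.
set K := k.+1; set s := \sum_(j < K) _.
(* Cyclic shift by [p] of the first [K] indices, extended by the identity to a permutation of
   nat. *)
pose rho p j := if (j < K)%N then ((j + p) %% K)%N else j.
have rho_bij p : (p <= K)%N -> bijective (rho p).
  have rho_inv q q' j : (q + q')%N = K -> rho q' (rho q j) = j.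
    move=> qq; rewrite /rho; case: (ltnP j K) => jK; last by rewrite ltnNge jK.
    by rewrite ltn_mod modnDml -addnA qq modnDr modn_small.
  move=> pK; exists (rho (K - p)%N) => j; apply: rho_inv; lia.
pose y q : cseq R := fun j => \sum_(p < q) (cmod (x (rho p j)))%:C%C.
have Xr p : (p <= K)%N -> X (x \o rho p) /\ nrm (x \o rho p) <= 1.
  by move=> pK; have [? ->] := nrm_perm (rho_bij p pK) Xx.
have Xc p : (p <= K)%N -> X (fun j => (cmod (x (rho p j)))%:C%C) /\
                 nrm (fun j => (cmod (x (rho p j)))%:C%C) <= 1.
  move=> /Xr[Xp p1]; have [|Xy y1] := @nrm_ideal _ (fun j => (cmod (x (rho p j)))%:C%C) Xp.
    by move=> j; rewrite cmod_cmod.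
  by split=> //; apply: le_trans y1 p1.
have yb q : (q <= K)%N -> X (y q) /\ nrm (y q) <= q%:R.
  elim: q => [_|q IH qK].
    rewrite (_ : y 0%N = szero R); first by rewrite nrm0; split=> //; case: XS => -[].
    by apply/funext => j; rewrite /y big_ord0.
  have [Xq q1] := IH (ltnW qK); have [Xp p1] := Xc q (ltnW qK).
  rewrite (_ : y q.+1 = sadd (y q) (fun j => (cmod (x (rho q j)))%:C%C)).
    split; first exact: lattice_add.
    by rewrite (le_trans (nrm_add Xq Xp))// -natr1 lerD.
  by apply/funext => j; rewrite /y big_ord_recr.
have [Xy yK] := yb K (leqnn _).
have s0 : 0 <= s by apply: sumr_ge0 => j _; apply: cmod_ge0.
apply: le_trans yK.
rewrite -{1}(cmodRge0 s0) -nrm_scale; last first.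
  by apply: (@finite_support_lattice K) => j; rewrite leqNgt /indic_seq => /negbTE ->.
apply: nrm_mono => // j; rewrite /sscale cmodM cmod_indic cmodRge0//.
case: ltnP => jK; last by rewrite mulr0 cmod_ge0.
rewrite mulr1 /y sum_RC cmodRge0 ?sumr_ge0// => [|p _]; last exact: cmod_ge0.
rewrite le_eqVlt; apply/orP; left; apply/eqP.
(* At a fixed index [j] the shifts visit every coordinate once, so [y K j] is the whole sum [s]. *)
pose h (p : 'I_K) : 'I_K := inord ((j + p) %% K).
have hE p : h p = ((j + p) %% K)%N :> nat by rewrite inordK// ltn_mod.
have h_inj : injective h.
  move=> p q /(congr1 val); rewrite /= !hE => /eqP; rewrite eqn_modDl => /eqP.
  by rewrite !modn_small// => /val_inj.
rewrite /s (reindex h) /=; last by apply: onW_bij; apply: injF_bij.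
by apply: eq_bigr => p _; rewrite hE /rho jK.
Qed.

(** [nrm_average] bounds every competitor in the supremum that defines [phi_dual]; this is phi_X(k)
    phi_X'(k) <= k. *)
Lemma nrm_indic_phi_dual k :
  nrm (indic_seq (fun j => (j < k)%N)) * phi_dual X nrm k <= k%:R.
Proof.
case: k => [|k].
  rewrite (_ : indic_seq (fun j => (j < 0)%N) = szero R) ?nrm0 ?mul0r//.
set v := indic_seq _; have Xv : X v.
  by apply: (@finite_support_lattice k.+1) => j; rewrite leqNgt /v /indic_seq => /negbTE ->.
have v0 : 0 < nrm v.
  have := coord_le_nrm 0 Xv; rewrite cmod_indic mul1r; apply: lt_le_trans.
  exact: nrm_unit_gt0.
rewrite mulrC -ler_pdivlMr//; apply: phi_dual_le => x Xx x1.
by rewrite ler_pdivlMr// nrm_average.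
Qed.

End SymmetricLattice.

(** * The finite sections [X_n] and the norms of indicator vectors *)

Section FiniteSections.
Variables (R : realType) (X : set (cseq R)) (nrm : cseq R -> R).
Hypothesis XS : symmetric_BSL X nrm.
Variable n : nat.
Implicit Types (z w : 'I_n -> R[i]).

Lemma extend_abs_ord z (i : 'I_n) : extend_abs z i = (cmod (z i))%:C%C.
Proof. by rewrite /extend_abs valK. Qed.

Lemma extend_abs_out z k : (n <= k)%N -> extend_abs z k = 0.
Proof. by move=> nk; rewrite /extend_abs insubN// -leqNgt. Qed.

Lemma extend_abs_ind (P : nat -> Prop) :
  (forall i : 'I_n, P i) -> (forall k, (n <= k)%N -> P k) -> forall k, P k.
Proof. by move=> Pi Pk k; case: (ltnP k n) => [kn|/Pk//]; apply: (Pi (Ordinal kn)). Qed.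

Lemma extend_abs_lattice z : X (extend_abs z).
Proof. by apply: (finite_support_lattice XS (n := n)) => k; apply: extend_abs_out. Qed.
Local Hint Resolve extend_abs_lattice : core.

Lemma Xn_norm_mono z w : (forall i, cmod (z i) <= cmod (w i)) ->
  Xn_norm nrm z <= Xn_norm nrm w.
Proof.
move=> zw; apply: (nrm_mono XS) => //; apply: extend_abs_ind => [i|k nk].
  by rewrite !extend_abs_ord !cmod_cmod.
by rewrite !extend_abs_out.
Qed.

Lemma Xn_norm_eq z w : (forall i, cmod (z i) = cmod (w i)) ->
  Xn_norm nrm z = Xn_norm nrm w.
Proof. by move=> zw; apply/le_anti; rewrite !Xn_norm_mono// => i; rewrite zw. Qed.

Lemma Xn_normZ a z : Xn_norm nrm (fun i => a * z i) = cmod a * Xn_norm nrm z.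
Proof.
rewrite /Xn_norm -(nrm_scale XS)//; apply: (nrm_eq_mod XS); first exact: (lattice_scale XS).
apply: extend_abs_ind => [i|k nk]; rewrite /sscale.
  by rewrite !extend_abs_ord cmod_cmod !cmodM cmod_cmod.
by rewrite !extend_abs_out// mulr0.
Qed.

Lemma Xn_normD z w :
  Xn_norm nrm (fun i => z i + w i) <= Xn_norm nrm z + Xn_norm nrm w.
Proof.
apply: le_trans (nrm_add XS _ _) => //; apply: (nrm_mono XS); first exact: (lattice_add XS).
apply: extend_abs_ind => [i|k nk]; rewrite /sadd.
  rewrite !extend_abs_ord cmod_cmod -rmorphD cmodRge0 ?cmodD// addr_ge0 ?cmod_ge0//.
by rewrite !extend_abs_out// addr0.
Qed.

Lemma Xn_norm_l1 z : Xn_norm nrm z <= 1 ->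
  \sum_(i < n) cmod (z i) <= phi_dual X nrm n.
Proof.
move=> z1; have := phi_dual_ub XS n (extend_abs_lattice z) z1; apply: le_trans.
by apply: ler_sum => i _; rewrite extend_abs_ord cmod_cmod.
Qed.

Lemma Xn_norm_coord z i : cmod (z i) * nrm (unit_seq R i) <= Xn_norm nrm z.
Proof.
by have := coord_le_nrm XS i (extend_abs_lattice z); rewrite extend_abs_ord cmod_cmod.
Qed.

Definition char_vec (J : {set 'I_n}) : 'I_n -> R[i] := fun i => (i \in J)%:R.

(* Some permutation of nat carries the initial segment of length #|J| onto J. *)
Lemma Xn_norm_char_vec (J : {set 'I_n}) :
  Xn_norm nrm (char_vec J) = nrm (indic_seq R (fun k => (k < #|J|)%N)).
Proof.
(* [l] lists 0, ..., n-1 with [J] first. Reading it by position gives the permutation [s], the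
   identity from [n] on, with inverse [t]. *)
pose l := [seq val i | i <- enum J ++ enum (~: J)].
have sz : size l = n.
  by rewrite size_map size_cat -!cardE -[RHS]card_ord (cardsC J).
have ul : uniq l.
  rewrite map_inj_uniq; last exact: val_inj.
  rewrite cat_uniq !enum_uniq andbT /= -all_predC; apply/allP => i /=.
  by rewrite !mem_enum inE.
have lE k : (k \in l) = (k < n)%N.
  apply/mapP/idP => [[i _ ->]//|]; first exact: ltn_ord.
  move=> kn; exists (Ordinal kn) => //.
  by rewrite mem_cat !mem_enum inE orbN.
pose s k := if (k < n)%N then nth 0%N l k else k.
pose t k := if (k < n)%N then index k l else k.
have sn k : (k < n)%N -> (s k < n)%N by move=> kn; rewrite /s kn -lE mem_nth ?sz.
have sK : cancel s t.
  move=> k; rewrite /t; case kn: (k < n)%N; last by rewrite /s !kn.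
  by rewrite sn// /s kn index_uniq ?sz.
have tK : cancel t s.
  move=> k; rewrite /t; case: (ltnP k n) => kn; last by rewrite /s ltnNge kn.
  have kl : k \in l by rewrite lE.
  by rewrite /s -{1}sz index_mem kl nth_index.
rewrite /Xn_norm; have [Xs <-] := nrm_perm XS (Bijective sK tK) (extend_abs_lattice (char_vec J)).
apply/esym/(nrm_eq_mod XS) => // k /=; rewrite cmod_indic.
have Jn : (#|J| <= n)%N by rewrite -[leqRHS]card_ord max_card.
case: (ltnP k n) => kn; last first.
  rewrite /s [(k < n)%N]ltnNge kn /= extend_abs_out// cmod0.
  by rewrite ltnNge (leq_trans Jn kn).
rewrite -[s k]/(val (Ordinal (sn k kn))) extend_abs_ord cmod_cmod /char_vec.
suff -> : (Ordinal (sn k kn) \in J) = (k < #|J|)%N.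
  by case: (_ < _)%N; rewrite ?cmod1 ?cmod0.
have i0 : 'I_n := Ordinal kn.
have -> : Ordinal (sn k kn) = nth i0 (enum J ++ enum (~: J)) k.
  apply: val_inj; rewrite /= /s kn (nth_map i0)//.
  by rewrite -[X in (_ < X)%N](size_map val) -/l sz.
rewrite nth_cat -cardE; case: ltnP => kJ.
  by rewrite -mem_enum mem_nth// -cardE.
have : nth i0 (enum (~: J)) (k - #|J|) \in ~: J.
  by rewrite -mem_enum mem_nth// -cardE ltn_subLR// cardsC card_ord.
by rewrite finset.in_setC => /negbTE.
Qed.

Lemma Xn_norm_char_vec_phi_dual (J : {set 'I_n}) :
  Xn_norm nrm (char_vec J) * phi_dual X nrm #|J| <= #|J|%:R.
Proof. by rewrite Xn_norm_char_vec (nrm_indic_phi_dual XS). Qed.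

End FiniteSections.

(** * Coefficients of tetrahedral polynomials *)

Section ElementarySymmetric.
Variables (R : realType) (n : nat).

(* prod_i (1 + t x_i) <= exp (t s), evaluated at t = k / s. *)
Lemma elem_sym_bound (x : 'I_n -> R) (s : R) (k : nat) :
  (forall i, 0 <= x i) -> \sum_i x i <= s -> 0 < s ->
  (\sum_(S : {set 'I_n} | #|S| == k) \prod_(i in S) x i) * k%:R ^+ k
    <= (expR 1 * s) ^+ k.
Proof.
move=> x0 xs s0; pose t := k%:R / s.
have t0 : 0 <= t by rewrite divr_ge0// ltW.
have key : \sum_(S : {set 'I_n} | #|S| == k) t ^+ k * \prod_(i in S) x i <= expR k%:R.
  have le1 : \prod_(i < n) (t * x i + 1) <= expR k%:R.
    have -> : k%:R = t * s by rewrite /t divfK// gt_eqF.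
    apply: (@le_trans _ _ (expR (t * \sum_i x i))); last by rewrite ler_expR ler_wpM2l.
    rewrite mulr_sumr expR_sum; apply: ler_prod => i _.
    by rewrite [t * _ + 1]addrC expR_ge1Dx andbT addr_ge0// mulr_ge0.
  (* Expand the product over subsets and discard the nonnegative terms whose size is not [k]. *)
  apply: le_trans le1; rewrite bigA_distr.
  rewrite [leRHS](bigID (fun S : {set 'I_n} => #|S| == k))/= ler_wpDr//.
    apply: sumr_ge0 => S _; apply: prodr_ge0 => i _.
    by case: ifP => // _; rewrite mulr_ge0.
  apply: ler_sum => S /eqP Sk.
  rewrite -[leRHS]big_mkcond /= big_split /= prodr_const Sk//.
have -> : (expR 1 * s) ^+ k = expR k%:R * s ^+ k.
  by rewrite exprMn -expRM_natl mulr1.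
rewrite -ler_pdivrMr ?exprn_gt0//.
by rewrite -mulrA -expr_div_n -/t mulrC mulr_sumr.
Qed.

End ElementarySymmetric.

Section TetrahedralPolynomials.
Variables (R : realType) (n : nat).
Implicit Types (z : 'I_n -> R[i]) (c : {set 'I_n} -> R[i]) (S J : {set 'I_n}).

Definition homog_part (m : nat) c : {set 'I_n} -> R[i] :=
  fun S => if #|S| == m then c S else 0.

Lemma monomZ S a z : monom S (fun i => a * z i) = a ^+ #|S| * monom S z.
Proof. by rewrite /monom big_split /= prodr_const. Qed.

Lemma cmod_monom S z : cmod (monom S z) = \prod_(i in S) cmod (z i).
Proof. exact: cmod_prod. Qed.

Lemma tetra_homog_partZ m c a z :
  tetra (homog_part m c) (fun i => a * z i) = a ^+ m * tetra (homog_part m c) z.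
Proof.
rewrite /tetra mulr_sumr; apply: eq_bigr => S _; rewrite monomZ /homog_part.
by case: eqP => [->|]; rewrite ?mul0r ?mulr0// mulrCA.
Qed.

Lemma card_set_ord S : (#|S| < n.+1)%N.
Proof. by rewrite ltnS -[leqRHS]card_ord max_card. Qed.

(** Restriction to the complex line through [z] yields a polynomial in [a] whose coefficients are
    the homogeneous parts, the form that [coef_bound] needs. *)
Lemma tetra_circle c a z :
  tetra c (fun i => a * z i) = \sum_(k < n.+1) tetra (homog_part k c) z * a ^+ k.
Proof.
under [RHS]eq_bigr do rewrite mulr_suml.
rewrite exchange_big; apply: eq_bigr => S _ /=.
rewrite (bigD1 (Ordinal (card_set_ord S)))//= big1 => [|k kS].
  by rewrite addr0 monomZ /homog_part eqxx mulrAC -mulrA.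
rewrite /homog_part; case: eqP => [Sk|]; last by rewrite !mul0r.
by case/eqP: kS; apply: val_inj.
Qed.

Lemma tetra_homog_part0 c z : tetra (homog_part 0 c) z = c finset.set0.
Proof.
rewrite /tetra (bigD1 finset.set0)//= /homog_part cards0 eqxx /monom big_set0 mulr1.
rewrite big1 ?addr0// => S S0; rewrite cards_eq0 (negbTE S0) mul0r//.
Qed.

Lemma homog_part_bound c z M m : (0 < m <= n)%N ->
  (forall a, cmod a = 1 -> cmod (tetra c (fun i => a * z i)) <= M) ->
  cmod (tetra (homog_part m c) z) <= 2 * (M - cmod (c finset.set0)).
Proof.
move=> mn cM; rewrite -lecR rmorphM rmorphB /= !cmodE rmorph_nat.
rewrite -(tetra_homog_part0 c z).
apply: (@coef_bound _ n m (fun k => tetra (homog_part k c) z)) => // w w1.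
by rewrite -tetra_circle -cmodE lecR cM//; apply: complexI; rewrite cmodE.
Qed.

Definition flip_coord (i : 'I_n) z : 'I_n -> R[i] :=
  fun j => (if j == i then -1 else 1) * z j.

Lemma monom_flip i S z :
  monom S (flip_coord i z) = (if i \in S then -1 else 1) * monom S z.
Proof.
rewrite /monom big_split /=; congr (_ * _); case: ifP => iS.
  by rewrite (bigD1 i)//= eqxx big1 ?mulr1// => j /andP[_ /negbTE ->].
by rewrite big1// => j jS; case: eqP => // ji; rewrite -ji jS in iS.
Qed.

(** Half the difference of the values at [z] and at [flip_coord i z] keeps exactly the terms with i
    in S. Doing this for each i in [J] never increases the bound, as [B] is stable under sign
    flips. *)
Lemma tetra_subset_bound (B : set ('I_n -> R[i])) c M J :
  (forall z w, (forall i, cmod (z i) = cmod (w i)) -> B z -> B w) ->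
  (forall z, B z -> cmod (tetra c z) <= M) ->
  forall z, B z -> cmod (tetra (fun S => if J \subset S then c S else 0) z) <= M.
Proof.
move=> Bph cM.
have H (s : seq 'I_n) z : B z ->
    cmod (tetra (fun S => if all (mem S) s then c S else 0) z) <= M.
  elim: s z => [|i s IH] z Bz /=; first exact: cM.
  have Bf : B (flip_coord i z).
    apply: Bph Bz => j; rewrite /flip_coord cmodM.
    by case: ifP; rewrite ?cmodN cmod1 mul1r.
  set d := fun S => if all (mem S) s then c S else 0.
  have -> : tetra (fun S => if (i \in S) && all (mem S) s then c S else 0) z =
      2^-1 * (tetra d z - tetra d (flip_coord i z)).
    rewrite /tetra -sumrB mulr_sumr; apply: eq_bigr => S _; rewrite monom_flip /d.
    case: (i \in S) => /=; last by rewrite mul1r subrr mul0r mulr0.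
    by field.
  rewrite cmodM -[2^-1](_ : (2^-1 : R)%:C%C = _) ?cmodRge0//; last first.
    by rewrite fmorphV rmorph_nat.
  have := cmodB (tetra d z) (tetra d (flip_coord i z)).
  by have := IH _ Bz; have := IH _ Bf; rewrite -/d; lra.
move=> z /(H (enum J)); congr (cmod _ <= _); apply: eq_bigr => S _.
have -> // : (J \subset S) = all (mem S) (enum J).
by apply/fintype.subsetP/allP => JS i; [rewrite mem_enum => /JS|rewrite -mem_enum => /JS].
Qed.

End TetrahedralPolynomials.

(** * Absolute coefficient sums of homogeneous parts *)

Section CoefficientBound.
Variables (R : realType) (X : set (cseq R)) (nrm : cseq R -> R).
Hypothesis XS : symmetric_BSL X nrm.
Variable n : nat.
Implicit Types (z : 'I_n -> R[i]) (c : {set 'I_n} -> R[i]) (S J : {set 'I_n}).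

Lemma Xn_ball_phase z w : (forall i, cmod (z i) = cmod (w i)) ->
  Xn_ball nrm z -> Xn_ball nrm w.
Proof. by move=> zw; rewrite /Xn_ball /= (Xn_norm_eq XS zw). Qed.

(* Evaluate the part of the polynomial containing J at (t 1_J + z') / 2, where z'
   vanishes on J and its phases make all remaining terms nonnegative. *)
Lemma extension_sum_bound k c M J z (t : R) :
  (forall w, Xn_ball nrm w -> cmod (tetra (homog_part k.+1 c) w) <= M) ->
  #|J| = k -> 0 <= t -> t * Xn_norm nrm (char_vec R J) <= 1 -> Xn_ball nrm z ->
  t ^+ k * \sum_(S : {set 'I_n} | (J \subset S) && (#|S| == k.+1))
     cmod (c S * monom (S :\: J) z) <= 2 ^+ k.+1 * M.
Proof.
move=> PM Jk t0 tJ Bz.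
have u_ex i : exists u, cmod u = 1 /\
    u * (c (i |: J) * z i) = (cmod (c (i |: J) * z i))%:C%C.
  by have [u] := phaseE (c (i |: J) * z i); exists u.
have [u uP] := choice u_ex.
pose v i : R[i] := (2^-1 : R)%:C%C *
  (t%:C%C * char_vec R J i + (if i \in J then 0 else u i * z i)).
have half0 : 0 <= 2^-1 :> R by rewrite invr_ge0.
have Bv : Xn_ball nrm v.
  rewrite /Xn_ball /= /v (Xn_normZ XS) cmodRge0//.
  have := Xn_normD XS (fun i => t%:C%C * char_vec R J i) (fun i => if i \in J then 0 else u i * z i).
  rewrite (Xn_normZ XS) cmodRge0//.
  have : Xn_norm nrm (fun i => if i \in J then 0 else u i * z i) <= Xn_norm nrm z.
    apply: (Xn_norm_mono XS) => i; case: ifP => _; first by rewrite cmod0 cmod_ge0.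
    by rewrite cmodM (uP i).1 mul1r.
  by move: Bz; rewrite /Xn_ball /=; lra.
have := tetra_subset_bound J Xn_ball_phase PM Bv.
have -> : tetra (fun S => if J \subset S then homog_part k.+1 c S else 0) v =
    (2^-1 ^+ k.+1 * (t ^+ k * \sum_(S : {set 'I_n} | (J \subset S) && (#|S| == k.+1))
       cmod (c S * monom (S :\: J) z)))%:C%C.
  rewrite !rmorphM /= -sum_RC !mulr_sumr [RHS]big_mkcond; apply: eq_bigr => S _.
  rewrite /homog_part; case: ifP => JS /=; last by rewrite mul0r.
  case: eqP => Sk; last by rewrite mul0r.
  (* Only one index of [S] lies outside [J], so a single phase per coordinate suffices to make every
     term nonnegative. *)
  have /cards1P[i SJ] : #|S :\: J| == 1%N.
    by rewrite cardsD (finset.setIidPr JS) Sk Jk subSnn.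
  have /setDP[iS iJ] : i \in S :\: J by rewrite SJ finset.set11.
  have SE : S = i |: J by rewrite -[LHS](setID _ J) SJ (finset.setIidPr JS) finset.setUC.
  rewrite SJ /monom big_set1 SE big_setU1//= /v /char_vec (negbTE iJ) mulr0 add0r.
  rewrite (eq_bigr (fun=> (2^-1 : R)%:C%C * t%:C%C)); last first.
    by move=> j jJ; rewrite jJ mulr1 addr0.
  rewrite prodr_const Jk -(uP i).2 !rmorphXn /= exprMn exprS; ring.
rewrite cmodRge0; last first.
  rewrite mulr_ge0 ?exprn_ge0// mulr_ge0 ?exprn_ge0// sumr_ge0// => S _; exact: cmod_ge0.
by rewrite exprVn mulrC ler_pdivrMr ?exprn_gt0// [M * _]mulrC.
Qed.

Lemma homog_abs_sum_bound k c M z : (0 < n)%N ->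
  (forall w, Xn_ball nrm w -> cmod (tetra (homog_part k.+1 c) w) <= M) ->
  Xn_ball nrm z ->
  (\sum_(S : {set 'I_n} | #|S| == k.+1) cmod (c S * monom S z)) * phi_dual X nrm k ^+ k
   <= (expR 1 * phi_dual X nrm n) ^+ k * (2 ^+ k.+1 * M).
Proof.
move=> n0 PM Bz.
have pn0 := phi_dual_gt0 XS n0.
have M0 : 0 <= M by apply: le_trans (PM z Bz); apply: cmod_ge0.
(* By phi_X(k) phi_X'(k) <= k this [t] is admissible in [extension_sum_bound] for every [J] of size
   [k]. For k = 0 the division gives t = 0, harmless since [t] only occurs as [t ^+ 0] there. *)
pose t : R := phi_dual X nrm k / k%:R.
have pk0 : 0 <= phi_dual X nrm k.
  apply: le_trans (phi_dual_ub XS k (extend_abs_lattice XS z) (ltW Bz)).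
  by apply: sumr_ge0 => i _; apply: cmod_ge0.
have t0 : 0 <= t by rewrite divr_ge0.
set T := \sum_(S | _) _.
pose E J := \prod_(i in J) cmod (z i).
have E0 J : 0 <= E J by apply: prodr_ge0 => i _; apply: cmod_ge0.
(* Each [S] of size k + 1 contains some [J] of size [k], and |z^S| = [E J] |z^(S \ J)|. One such [J]
   per [S] is enough; the other terms are nonnegative. *)
have step1 : T <= \sum_(J : {set 'I_n} | #|J| == k) E J *
    \sum_(S : {set 'I_n} | (J \subset S) && (#|S| == k.+1)) cmod (c S * monom (S :\: J) z).
  under eq_bigr do rewrite mulr_sumr.
  rewrite (exchange_big_dep (fun S : {set 'I_n} => #|S| == k.+1)) /=; last first.
    by move=> J S _ /andP[].
  apply: ler_sum => S /eqP Sk.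
  have /card_gt0P[i iS] : (0 < #|S|)%N by rewrite Sk.
  have Si : #|S :\ i| = k by have := cardsD1 i S; rewrite iS Sk => -[].
  rewrite (bigD1 (S :\ i))/=; last by rewrite Si Sk !eqxx subD1set.
  rewrite ler_wpDr//.
    by apply: sumr_ge0 => J _; rewrite mulr_ge0// cmod_ge0.
  rewrite /E -cmod_monom -cmodM mulrCA.
  rewrite [monom S z](big_setID (S :\ i)) /= (finset.setIidPr _)//; exact: subD1set.
have step2 : T * t ^+ k <= (\sum_(J : {set 'I_n} | #|J| == k) E J) * (2 ^+ k.+1 * M).
  apply: (le_trans (ler_wpM2r (exprn_ge0 k t0) step1)).
  rewrite !mulr_suml; apply: ler_sum => J /eqP Jk.
  rewrite -mulrA ler_wpM2l// mulrC (extension_sum_bound PM)//.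
  have := Xn_norm_char_vec_phi_dual XS J; rewrite Jk /t.
  case: (posnP k) => [->|k0]; first by rewrite invr0 mulr0 mul0r.
  by rewrite mulrAC ler_pdivrMr ?ltr0n// mul1r mulrC.
have step3 := @elem_sym_bound _ n (fun i => cmod (z i)) (phi_dual X nrm n) k
  (fun i => cmod_ge0 _) (Xn_norm_l1 XS (ltW Bz)) pn0.
have -> : phi_dual X nrm k ^+ k = t ^+ k * k%:R ^+ k.
  rewrite /t; case: (posnP k) => [->|k0]; first by rewrite !expr0 mulr1.
  by rewrite -exprMn divfK// pnatr_eq0 -lt0n.
rewrite mulrA; apply: (le_trans (ler_wpM2r (exprn_ge0 k (ler0n _ _)) step2)).
rewrite mulrAC; apply: ler_wpM2r => //.
by rewrite mulr_ge0 ?exprn_ge0.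
Qed.

End CoefficientBound.

(** * The lower bound for the Bohr radius *)

Section BohrLowerBound.
Variables (R : realType) (X : set (cseq R)) (nrm : cseq R -> R).
Hypothesis XS : symmetric_BSL X nrm.
Variable n : nat.
Implicit Types (z : 'I_n -> R[i]) (c : {set 'I_n} -> R[i]).

Lemma bohr_radius_ge r : 0 < r < 1 -> bohr_ok nrm n r -> r <= bohr_radius nrm n.
Proof.
move=> r01 ok; apply: ub_le_sup; last by split.
by exists 1 => s [/andP[_ /ltW]].
Qed.

Lemma bohr_radius_ge0 : 0 <= bohr_radius nrm n.
Proof.
(* Without admissible radii, [sup] takes its default value 0. *)
have [|/set0P[r [r01 ok]]] := eqVneq [set r : R | 0 < r < 1 /\ bohr_ok nrm n r] set0.
  by rewrite /bohr_radius => ->; rewrite sup0.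
by apply: le_trans (bohr_radius_ge r01 ok); case/andP: r01 => /ltW.
Qed.

Lemma sum_by_card (F : {set 'I_n} -> R) :
  \sum_S F S = F finset.set0 + \sum_(k < n) \sum_(S : {set 'I_n} | #|S| == k.+1) F S.
Proof.
rewrite (partition_big (fun S => Ordinal (card_set_ord S)) xpredT)//= big_ord_recl.
congr (_ + _).
rewrite (big_pred1 finset.set0)// => S; rewrite -val_eqE /= cards_eq0//.
Qed.

Lemma bohr_ok_of_bound (r : R) : 0 <= r ->
  (forall c M z, (forall w, Xn_ball nrm w -> cmod (tetra c w) <= M) -> Xn_ball nrm z ->
    \sum_(S : {set 'I_n}) r ^+ #|S| * cmod (c S * monom S z) <= M) ->
  bohr_ok nrm n r.
Proof.
move=> r0 H c; apply: ge_ereal_sup => _ [_ [w Bw <-] <-].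
have -> : \sum_(S : {set 'I_n}) cmod (c S * monom S (fun i => r%:C%C * w i)) =
    \sum_(S : {set 'I_n}) r ^+ #|S| * cmod (c S * monom S w).
  apply: eq_bigr => S _; rewrite monomZ mulrCA exp_RC [LHS]cmodM cmodRge0//.
  exact: exprn_ge0.
set s := ereal_sup _.
have ub z : Xn_ball nrm z -> ((cmod (tetra c z))%:E <= s)%E.
  by move=> Bz; apply: ereal_sup_ubound; exists z.
(* A finite supremum serves as [M], the value +oo is trivial, and -oo is excluded because the ball
   contains [w]. *)
case: s ub => [M| |] ub; last by have := ub w Bw.
  by rewrite lee_fin; apply: H => // z /ub; rewrite lee_fin.
exact: leey.
Qed.

Lemma geometric_quarter m : \sum_(k < m) 2 * (4^-1 : R) ^+ k.+1 <= 1.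
Proof.
suff : \sum_(k < m) 2 * (4^-1 : R) ^+ k.+1 <= 1 - 4^-1 ^+ m.
  by have := exprn_ge0 m (_ : 0 <= 4^-1 :> R) => /(_ (ltac:(by rewrite invr_ge0))); lra.
elim: m => [|m IH]; first by rewrite big_ord0 expr0 subrr.
rewrite big_ord_recr /= exprS; move: IH.
have : 0 <= (4^-1 : R) ^+ m by rewrite exprn_ge0// invr_ge0.
set s := \sum_(_ < _) _; set q := _ ^+ m; lra.
Qed.

Lemma bohr_radius_lower : (1 <= n)%N ->
  inf [set powR (phi_dual X nrm m.-1 / phi_dual X nrm n) (m.-1%:R / m%:R)
      | m in [set m : nat | (1 <= m <= n)%N]]
  <= 8 * expR 1 * bohr_radius nrm n.
Proof.
move=> n1; set A := [set _ | _ in _]; set Q := inf A.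
have e1 : 1 <= expR 1 :> R by rewrite -expR0 ler_expR.
have [Q0|Q0] := leP Q 0.
  by apply: le_trans Q0 _; rewrite mulr_ge0 ?bohr_radius_ge0//; lra.
have pn0 := phi_dual_gt0 XS n1.
have lbA m : (1 <= m <= n)%N ->
    Q <= powR (phi_dual X nrm m.-1 / phi_dual X nrm n) (m.-1%:R / m%:R).
  move=> mn; apply: ge_inf; last by exists m.
  by exists 0 => _ [m' _ <-]; apply: powR_ge0.
(* For m = 1 the exponent is 0 and the competitor equals 1; this keeps [r] below 1. *)
have Q1 : Q <= 1.
  by have := lbA 1%N; rewrite /= n1 mul0r powRr0; apply.
(* In 8 e = 2 * 4 * e, the 2 absorbs [2 ^+ k.+1] from the coefficient bound, e absorbs
   [expR 1 ^+ k], and the 4 leaves geometric decay. *)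
pose r := Q / (8 * expR 1).
have r0 : 0 < r by rewrite divr_gt0//; lra.
rewrite mulrC -ler_pdivrMr; last lra.
rewrite -/r; apply: bohr_radius_ge.
  by rewrite r0 /r ltr_pdivrMr; lra.
apply: bohr_ok_of_bound => [|c M z cM Bz]; first exact: ltW.
rewrite sum_by_card cards0 mul1r {1}/monom big_set0 mulr1.
have M0 : cmod (c finset.set0) <= M.
  have B0 : Xn_ball nrm (fun i => 0 * z i).
    by rewrite /Xn_ball /= (Xn_normZ XS) cmod0 mul0r.
  apply: le_trans (cM _ B0); rewrite tetra_circle big_ord_recl tetra_homog_part0.
  rewrite expr0 mulr1 big1 ?addr0// => k _; by rewrite exprS mul0r mulr0.
(* The parts of positive degree must sum to at most this slack, and by [homog_part_bound] each of
   them is at most twice it on the ball. *)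
set M' := M - cmod (c finset.set0).
have M'0 : 0 <= M' by rewrite subr_ge0.
suff H (k : 'I_n) : \sum_(S : {set 'I_n} | #|S| == k.+1)
    r ^+ #|S| * cmod (c S * monom S z) <= 2 * 4^-1 ^+ k.+1 * M'.
  rewrite -lerBrDl -/M'; apply: le_trans (ler_sum _ (fun k _ => H k)) _.
  by rewrite -mulr_suml ler_piMl// geometric_quarter.
have PM w : Xn_ball nrm w -> cmod (tetra (homog_part k.+1 c) w) <= 2 * M'.
  move=> Bw; apply: homog_part_bound => //; first exact: ltn_ord.
  move=> a a1; apply: cM; apply: (Xn_ball_phase XS) Bw => i.
  by rewrite cmodM a1 mul1r.
have := homog_abs_sum_bound XS n1 PM Bz; set T := \sum_(S | _) _ => TM.
have -> : \sum_(S : {set 'I_n} | #|S| == k.+1) r ^+ #|S| * cmod (c S * monom S z)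
    = r ^+ k.+1 * T.
  by rewrite /T mulr_sumr; apply: eq_bigr => S /eqP ->.
have T0 : 0 <= T by apply: sumr_ge0 => S _; apply: cmod_ge0.
have pk : 0 <= phi_dual X nrm k.
  case: (posnP k) => [->|/(phi_dual_gt0 XS)/ltW//].
  by have := phi_dual_ub XS 0 (extend_abs_lattice XS z) (ltW Bz); rewrite big_ord0.
(* The competitor m = k + 1 raised to the power k + 1, which clears the exponent k / (k + 1). *)
have Qk : Q ^+ k.+1 * phi_dual X nrm n ^+ k <= phi_dual X nrm k ^+ k.
  rewrite -ler_pdivlMr ?exprn_gt0// -expr_div_n.
  have /= := lbA k.+1 (ltn_ord k); set a := phi_dual X nrm k / _ => Qa.
  have a0 : 0 <= a by rewrite divr_ge0// ltW.
  rewrite -(powR_mulrn k a0) -[X in powR _ X](@divfK _ k.+1%:R) ?pnatr_eq0//.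
  rewrite powRrM powR_mulrn ?powR_ge0//.
  by rewrite lerXn2r// nnegrE ?powR_ge0// ltW.
have TQ : T * Q ^+ k.+1 <= expR 1 ^+ k * (2 ^+ k.+1 * (2 * M')).
  rewrite -(ler_pM2r (exprn_gt0 k pn0)) -mulrA.
  apply: le_trans (ler_wpM2l T0 Qk) _; apply: le_trans TM _.
  by rewrite exprMn le_eqVlt; apply/orP; left; apply/eqP; ring.
rewrite /r expr_div_n mulrC mulrA ler_pdivrMr ?exprn_gt0//.
apply: le_trans TQ _.
rewrite !exprMn (_ : 8 = 2 * 4 :> R); last by rewrite -natrM.
rewrite exprMn exprVn.
have -> : 2 * 4 ^- k.+1 * M' * (2 ^+ k.+1 * 4 ^+ k.+1 * expR 1 ^+ k.+1) =
    expR 1 ^+ k.+1 * (2 ^+ k.+1 * (2 * M')).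
  by field; rewrite expf_neq0// pnatr_eq0.
apply: ler_wpM2r; first by rewrite !mulr_ge0 ?exprn_ge0.
by rewrite exprS ler_peMl// exprn_ge0// expR_ge0.
Qed.

End BohrLowerBound.

(** * Random tetrahedral polynomials *)

Section RandomSigns.
Variable R : realType.

Lemma expR_le_inv (x : R) : x < 1 -> expR x <= (1 - x)^-1.
Proof.
move=> x1; rewrite -[x in expR x]opprK expRN lef_pV2 ?posrE ?expR_gt0 ?subr_gt0//.
exact: expR_ge1Dx.
Qed.

(** The bounds 1/(1 - x) and 1/(1 + x) add up to 2/(1 - x^2), which is at most 2 (1 + 2 x^2) once
    x^2 <= 1/2. *)
Lemma cosh_le (x : R) : `|x| <= 2^-1 -> expR x + expR (- x) <= 2 * expR (2 * x ^+ 2).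
Proof.
rewrite ler_norml => /andP[xl xu].
have e1 := expR_le_inv (_ : x < 1); have e2 := expR_le_inv (_ : - x < 1).
have e3 := expR_ge1Dx (2 * x ^+ 2).
have x2 : x ^+ 2 <= 2^-1 by nra.
apply: (@le_trans _ _ (2 * (1 + 2 * x ^+ 2))); last lra.
apply: (le_trans (lerD (e1 _) (e2 _))); try lra.
have -> : (1 - x)^-1 + (1 - - x)^-1 = 2 / (1 - x ^+ 2).
  by field; rewrite !gt_eqF//; nra.
rewrite ler_pdivrMr; last nra.
have := sqr_ge0 x; set y := x ^+ 2 in x2 *; nra.
Qed.

Lemma exists_le_average (T : finType) (t0 : T) (F : T -> R) (K : R) :
  \sum_t F t <= #|T|%:R * K -> exists t, F t <= K.
Proof.
move=> FK; have [t _ tmin] := @Order.TotalTheory.arg_minP _ _ _ t0 xpredT F isT.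
exists t; have T0 : 0 < #|T|%:R :> R by rewrite ltr0n; apply/card_gt0P; exists t0.
rewrite -(ler_pM2l T0); apply: le_trans FK.
by rewrite mulr_natl -sumr_const; apply: ler_sum => s _; apply: tmin.
Qed.

Definition sign (b : bool) : R := (-1) ^+ b.

(* Chernoff's bound at the fixed parameter 1/2; a bound logarithmic in #|I| is all
   that is needed, so the parameter need not be optimized. *)
Lemma sign_choice (T I : finType) (a : I -> T -> R) :
  (forall i, \sum_t a i t ^+ 2 <= 1) ->
  exists eps : {ffun T -> bool}, forall i,
    `|\sum_t sign (eps t) * a i t| <= 2 * ln (2 * #|I|%:R) + 1.
Proof.
move=> a1; pose L eps i := \sum_t sign (eps t) * a i t.
have abs_a i t : `|a i t| <= 1.
  rewrite -(@expr_le1 _ 2)// real_normK ?num_real//; apply: le_trans (a1 i).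
  by rewrite (bigD1 t)//= lerDl sumr_ge0// => s _; apply: sqr_ge0.
have mgf i (s : R) : s ^+ 2 = 4^-1 ->
    \sum_(eps : {ffun T -> bool}) expR (s * L eps i) <= (2 ^ #|T|)%:R * expR 2^-1.
  (* Independence of the signs: the sum over all choices factors coordinate by coordinate. *)
  move=> s2; have -> : \sum_(eps : {ffun T -> bool}) expR (s * L eps i) =
      \prod_t \sum_b expR (s * (sign b * a i t)).
    rewrite bigA_distr_bigA; apply: eq_bigr => eps _.
    by rewrite mulr_sumr expR_sum.
  have -> : (2 ^ #|T|)%:R = \prod_(t : T) 2 :> R by rewrite prodr_const natrX.
  apply: (@le_trans _ _ ((\prod_(t : T) 2) * expR (\sum_t a i t ^+ 2 / 2))); last first.
    rewrite ler_wpM2l ?prodr_ge0// ler_expR -mulr_suml.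
    by rewrite -[leRHS]mul1r ler_wpM2r// invr_ge0.
  rewrite expR_sum -big_split /=; apply: ler_prod => t _.
  rewrite sumr_ge0/= => [|b _]; last exact: expR_ge0.
  rewrite big_bool /= /sign expr1 expr0 mulN1r mul1r mulrN addrC.
  have := @cosh_le (s * a i t); rewrite exprMn s2.
  have -> : 2 * (4^-1 * a i t ^+ 2) = a i t ^+ 2 / 2 by field.
  apply; rewrite -(@ler_pXn2r _ 2)// ?nnegrE ?normr_ge0 ?invr_ge0//.
  rewrite real_normK ?num_real// exprMn s2 exprVn.
  have -> : 2 ^+ 2 = 4 :> R by rewrite -natrX.
  rewrite ler_piMr ?invr_ge0// -[a i t ^+ 2]real_normK ?num_real// exprn_ile1//.
(* Summing both exponentials over all [i] lets one [eps] with [W eps] at most average control every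
   [L eps i] at once. *)
pose W eps := \sum_i (expR (2^-1 * L eps i) + expR (- 2^-1 * L eps i)).
have [|eps Weps] := @exists_le_average _ [ffun=> true] W (2 * #|I|%:R * expR 2^-1).
  rewrite exchange_big card_ffun card_bool.
  apply: (@le_trans _ _ (\sum_(i : I) (2 ^ #|T|)%:R * (2 * expR 2^-1))).
    apply: ler_sum => i _; rewrite big_split /= mulrCA mulr_natl mulr2n lerD// mgf//.
    - by field.
    - by field.
  by rewrite sumr_const -mulr_natr le_eqVlt; apply/orP; left; apply/eqP; ring.
exists eps => i; rewrite -/(L eps i).
have I0 : 0 < #|I|%:R :> R by rewrite ltr0n; apply/card_gt0P; exists i.
have Wi : expR (2^-1 * `|L eps i|) <= W eps.
  rewrite /W (bigD1 i)//= ler_wpDr//.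
    by apply: sumr_ge0 => j _; rewrite addr_ge0 ?expR_ge0.
  case: (ger0P (L eps i)) => _; first by rewrite lerDl expR_ge0.
  by rewrite mulrN -mulNr lerDr expR_ge0.
have := le_trans Wi Weps.
rewrite -[X in X * expR _]lnK ?posrE ?mulr_gt0// -expRD ler_expR.
set l := ln _; set y := `|_|; lra.
Qed.

End RandomSigns.

(** * Maxima of tetrahedral polynomials over polydiscs *)

Section Multiaffine.
Variables (R : realType) (n : nat).
Implicit Types (z : 'I_n -> R[i]) (c : {set 'I_n} -> R[i]).

Definition upd z (i : 'I_n) (u : R[i]) : 'I_n -> R[i] :=
  fun j => if j == i then u else z j.

Lemma upd_id z i : upd z i (z i) = z.
Proof. by apply/funext => j; rewrite /upd; case: eqP => [->|]. Qed.

Lemma tetra_affine c z i (l u v : R[i]) :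
  tetra c (upd z i ((1 - l) * u + l * v)) =
  (1 - l) * tetra c (upd z i u) + l * tetra c (upd z i v).
Proof.
rewrite /tetra !mulr_sumr -big_split; apply: eq_bigr => S _ /=.
have E w : monom S (upd z i w) =
    (if i \in S then w else 1) * \prod_(j in S :\ i) z j.
  have rest : \prod_(j in S :\ i) upd z i w j = \prod_(j in S :\ i) z j.
    by apply: eq_bigr => j; rewrite !finset.inE /upd => /andP[/negbTE ->].
  rewrite /monom; case: ifP => iS.
    by rewrite (big_setD1 i)//= rest /upd eqxx.
  rewrite -rest mul1r; apply: eq_bigl => j; rewrite !finset.inE.
  by case: eqP => // ->; rewrite iS.
by rewrite !E; case: (i \in S); ring.
Qed.

Lemma tetra_segment c z i (l M : R) (u v : R[i]) : 0 <= l <= 1 ->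
  cmod (tetra c (upd z i u)) <= M -> cmod (tetra c (upd z i v)) <= M ->
  cmod (tetra c (upd z i ((1 - l%:C%C) * u + l%:C%C * v))) <= M.
Proof.
move=> /andP[l0 l1] uM vM; rewrite tetra_affine.
apply: le_trans (cmodD _ _) _; rewrite !cmodM -[1 - _](_ : (1 - l)%:C%C = _); last first.
  by rewrite rmorphB.
rewrite !cmodRge0 ?subr_ge0//; nra.
Qed.

(** Vertices of the square circumscribed about the unit disc: four points control an affine function
    on the whole disc. *)
Definition corner (b : bool * bool) : R[i] := Complex (sign R b.1) (sign R b.2).

Lemma disc_max c z i (rho M : R) : 0 < rho -> cmod (z i) <= rho ->
  (forall b, cmod (tetra c (upd z i (rho%:C%C * corner b))) <= M) ->
  cmod (tetra c z) <= M.
Proof.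
move=> r0 zr cM; rewrite -(upd_id z i); case zE: (z i) => [x y].
have xr : `|x| <= rho by apply: le_trans zr; have := ler_Re_cmod (z i); rewrite zE.
have yr : `|y| <= rho by apply: le_trans zr; have := ler_Im_cmod (z i); rewrite zE.
(* Barycentric coordinate of [t] in [-rho, rho]; [x] and then [y] are interpolated between sides of
   the square. Note that [sign R true] is -1. *)
pose l (t : R) := (1 + t / rho) / 2.
have l01 t : `|t| <= rho -> 0 <= l t <= 1.
  rewrite ler_norml => /andP[tl tu]; rewrite /l.
  have : -1 <= t / rho by rewrite ler_pdivlMr// mulN1r.
  have : t / rho <= 1 by rewrite ler_pdivrMr// mul1r.
  by move=> ? ?; apply/andP; split; lra.
have rn0 : rho != 0 by rewrite gt_eqF.
have horiz b2 : cmod (tetra c (upd z i (Complex x (rho * sign R b2)))) <= M.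
  have -> : Complex x (rho * sign R b2) =
     (1 - (l x)%:C%C) * (rho%:C%C * corner (true, b2)) +
     (l x)%:C%C * (rho%:C%C * corner (false, b2)).
    apply/eqP; rewrite eq_complex /corner /sign /l /= expr1 expr0.
    by apply/andP; split; apply/eqP; field.
  by apply: tetra_segment => //; apply: l01.
have -> : Complex x y = (1 - (l y)%:C%C) * Complex x (rho * sign R true) +
    (l y)%:C%C * Complex x (rho * sign R false).
  apply/eqP; rewrite eq_complex /sign /l /= expr1 expr0.
  by apply/andP; split; apply/eqP; field.
by apply: tetra_segment => //; apply: l01.
Qed.

Lemma polydisc_max c (rho : 'I_n -> R) (M : R) : (forall i, 0 < rho i) ->
  (forall eta : 'I_n -> bool * bool,
     cmod (tetra c (fun i => (rho i)%:C%C * corner (eta i))) <= M) ->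
  forall z, (forall i, cmod (z i) <= rho i) -> cmod (tetra c z) <= M.
Proof.
move=> r0 cM.
(* [s] contains the coordinates not yet moved to a corner; the induction moves them one at a
   time. *)
have H (s : seq 'I_n) z :
    (forall j, (exists b, z j = (rho j)%:C%C * corner b) \/ (j \in s /\ cmod (z j) <= rho j)) ->
    cmod (tetra c z) <= M.
  elim: s z => [|i s IH] z zP.
    have /choice[eta etaP] : forall j, exists b, z j = (rho j)%:C%C * corner b.
      by move=> j; case: (zP j) => // -[].
    by rewrite (_ : z = fun j => (rho j)%:C%C * corner (eta j)); [exact: cM|exact/funext].
  have vtx b : cmod (tetra c (upd z i ((rho i)%:C%C * corner b))) <= M.
    apply: IH => j; rewrite /upd; case: (eqVneq j i) => [->|ji]; first by left; exists b.
    case: (zP j) => [|[]]; first by left.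
    by rewrite in_cons (negbTE ji); right.
  case: (zP i) => [[b zb]|[_ zi]]; first by rewrite -(upd_id z i) zb.
  exact: disc_max vtx.
by move=> z zr; apply: (H (enum 'I_n)) => j; right; rewrite mem_enum.
Qed.

Lemma cmod_corner b : cmod (corner b) <= 2.
Proof.
apply: le_trans (cmod_le_ReIm _) _; rewrite /corner /sign /=.
by rewrite !normrX !normrN1 !expr1n.
Qed.

End Multiaffine.

(** * Random polynomials that are small on the unit ball of [l_r] *)

Section SmallPolynomial.
Variables (R : realType) (r : R).
Hypothesis r12 : 1 <= r <= 2.

Let r_ge0 : 0 <= r. Proof. by case/andP: r12 => ? _; apply: le_trans ler01 _. Qed.
Let r_gt0 : 0 < r. Proof. by case/andP: r12 => ? _; apply: lt_le_trans ltr01 _. Qed.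

Lemma powR_mono (x y : R) : 0 <= x -> x <= y -> powR x r <= powR y r.
Proof.
by move=> x0 xy; apply: ge0_ler_powR => //; rewrite nnegrE// (le_trans x0).
Qed.

Lemma powR_le1 (x : R) : 0 <= x -> powR x r <= 1 -> x <= 1.
Proof.
move=> x0; apply: contraTT; rewrite -!ltNge => x1.
have -> : 1 = powR 1 r by rewrite powR1.
by apply: gt0_ltr_powR; rewrite ?nnegrE.
Qed.

Lemma powRK (x : R) : 0 <= x -> powR (powR x r^-1) r = x.
Proof. by move=> x0; rewrite -powRrM mulVf ?gt_eqF// powRr1. Qed.

Lemma powR_double (x : R) : 0 <= x -> powR (2 * x) r <= 4 * powR x r.
Proof.
move=> x0; rewrite powRM// ler_wpM2r ?powR_ge0//.
apply: (@le_trans _ _ (powR 2 2)); first by rewrite ler_powR ?ler1n//; case/andP: r12.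
by rewrite powR_mulrn// -natrX.
Qed.

Lemma powR_add (x y : R) : 0 <= x -> 0 <= y ->
  powR (x + y) r <= 4 * (powR x r + powR y r).
Proof.
move=> x0 y0; have px := powR_ge0 x r; have py := powR_ge0 y r.
have [xy|/ltW yx] := leP x y.
  have := powR_mono (_ : 0 <= x + y) (_ : x + y <= 2 * y).
  by have := powR_double y0; move=> h /(_ ltac:(lra) ltac:(lra)); lra.
have := powR_mono (_ : 0 <= x + y) (_ : x + y <= 2 * x).
by have := powR_double x0; move=> h /(_ ltac:(lra) ltac:(lra)); lra.
Qed.

Lemma powR_prod (I : finType) (P : pred I) (F : I -> R) : (forall i, 0 <= F i) ->
  powR (\prod_(i | P i) F i) r = \prod_(i | P i) powR (F i) r.
Proof.
move=> F0; suff [] : 0 <= \prod_(i | P i) F i /\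
  powR (\prod_(i | P i) F i) r = \prod_(i | P i) powR (F i) r by [].
elim/big_rec2: _ => [|i y x _ [x0 <-]]; first by rewrite powR1.
by rewrite mulr_ge0// powRM.
Qed.

Lemma sqr_le_powR (x : R) : 0 <= x <= 1 -> x ^+ 2 <= powR x r.
Proof.
move=> /andP[]; rewrite le_eqVlt => /predU1P[<-|x0] x1.
  by rewrite expr0n powR_ge0.
rewrite -(powR_mulrn 2 (ltW x0)); apply: ger_powR; first by rewrite x0.
by case/andP: r12.
Qed.

(** The integer counts grid points times the choice of real or imaginary part. By ln x <= x its
    logarithm is of order at most n^2, and n^6 >= 64 absorbs the constants. *)
Lemma ln_grid_bound n : (2 <= n)%N ->
  2 * (2 * ln (2 * ((n.+2 * 4) ^ n * 2)%:R) + 1) <= n%:R ^+ 8 :> R.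
Proof.
move=> n2; set N : R := n%:R; have N2 : 2 <= N by rewrite ler_nat.
have ln_lt (x : R) : 0 < x -> ln x <= x.
  by move=> x0; rewrite -ler_expR lnK ?posrE// (le_trans _ (expR_ge1Dx x))// lerDr.
have -> : 2 * ((n.+2 * 4) ^ n * 2)%:R = 4 * ((N + 2) * 4) ^+ n :> R.
  have nE : n.+2%:R = N + 2 :> R by rewrite -addn2 natrD.
  by rewrite natrM natrX natrM nE; ring.
rewrite lnM ?posrE ?exprn_gt0//; try lra.
rewrite lnXn; last lra.
have h4 := ln_lt 4 ltac:(lra).
have hN : ln ((N + 2) * 4) *+ n <= N * ((N + 2) * 4).
  by rewrite -[ln _ *+ n]mulr_natl ler_wpM2l// ln_lt//; lra.
have N6 : 64 <= N ^+ 6.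
  have -> : 64 = 2 ^+ 6 :> R by rewrite -natrX.
  by rewrite lerXn2r// nnegrE//; lra.
have -> : N ^+ 8 = N ^+ 6 * N ^+ 2 by rewrite -exprD.
apply: (@le_trans _ _ (64 * N ^+ 2)); last by rewrite ler_wpM2r// sqr_ge0.
have := hN; set u := _ *+ n; nra.
Qed.

(** Its r-th power is (32 e / m)^m, the bound of [elem_sym_bound] for degree [m] and coordinate sum
    32. *)
Definition lr_const (m : nat) : R := powR (32 * expR 1 / m%:R) r^-1 ^+ m.

Lemma exists_small_polynomial n m : (2 <= n)%N -> (0 < m)%N ->
  exists eps : {set 'I_n} -> bool, forall z : 'I_n -> R[i],
    \sum_i powR (cmod (z i)) r <= 1 ->
    cmod (tetra (homog_part m (fun S => (sign R (eps S))%:C%C)) z)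
      <= lr_const m * n%:R ^+ 8.
Proof.
move=> n2 m0; have N0 : 0 < n%:R :> R by rewrite ltr0n (leq_trans _ n2).
pose grid (p : {ffun 'I_n -> 'I_n.+2 * (bool * bool)}) (i : 'I_n) : R[i] :=
  ((p i).1%:R / n%:R : R)%:C%C * corner R (p i).2.
(* 32 = 4 * 4 * 2: a factor 4 for corners of modulus up to 2, a factor 4 from [powR_add], and a sum
   at most 1 + n * (1/n) after rounding. *)
pose good p := \sum_i powR (cmod (grid p i)) r <= 32.
pose A := lr_const m.
have base0 : 0 < 32 * expR 1 / m%:R :> R.
  by rewrite divr_gt0 ?mulr_gt0 ?expR_gt0 ?ltr0n.
have A0 : 0 < A by rewrite /A /lr_const exprn_gt0// powR_gt0.
have Ai0 : 0 <= A^-1 by rewrite invr_ge0 ltW.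
have Ar : powR A r = (32 * expR 1 / m%:R) ^+ m.
  rewrite /A /lr_const -powR_mulrn ?powR_ge0// -[LHS]powRrM.
  rewrite [m%:R * r]mulrC [LHS]powRrM powRK; last exact: ltW.
  by rewrite powR_mulrn// ltW.
(* The flag [q.2] selects the real or imaginary part. Rows of points that are not [good] are zero,
   so that [sign_choice] applies to all rows. *)
pose a (q : {ffun 'I_n -> 'I_n.+2 * (bool * bool)} * bool) (S : {set 'I_n}) : R :=
  if good q.1 && (#|S| == m) then
    (if q.2 then complex.Re (monom S (grid q.1)) else complex.Im (monom S (grid q.1))) / A
  else 0.
have a1 q : \sum_S a q S ^+ 2 <= 1.
  case: q => p b; rewrite /a /=; case gp: (good p) => /=; last first.
    by rewrite big1// => S _; rewrite expr0n.
  pose x i := powR (cmod (grid p i)) r.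
  pose y S := cmod (monom S (grid p)) / A.
  have yr S : powR (y S) r = (\prod_(i in S) x i) / powR A r.
    rewrite /y powRM ?cmod_ge0// -(powR_inv1 (ltW A0)) -powRrM mulN1r powRN.
    by rewrite cmod_monom powR_prod// => i; apply: cmod_ge0.
  have sum_y : \sum_(S : {set 'I_n} | #|S| == m) powR (y S) r <= 1.
    under eq_bigr do rewrite yr.
    rewrite -mulr_suml ler_pdivrMr ?powR_gt0// mul1r Ar expr_div_n.
    rewrite ler_pdivlMr ?exprn_gt0 ?ltr0n// [32 * _]mulrC.
    by apply: elem_sym_bound => // i; apply: powR_ge0.
  rewrite (bigID (fun S : {set 'I_n} => #|S| == m))/= [X in _ + X]big1 ?addr0; last first.
    by move=> S /negbTE ->; rewrite expr0n.
  (* As r <= 2 and [y S] <= 1, squares are dominated by r-th powers. *)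
  apply: le_trans (sum_y); apply: ler_sum => S Sm; rewrite Sm.
  have y0 T : 0 <= y T by rewrite divr_ge0 ?cmod_ge0// ltW.
  have y1 : y S <= 1.
    apply: powR_le1 => //; apply: le_trans sum_y; rewrite (bigD1 S)//= lerDl.
    by apply: sumr_ge0 => T _; apply: powR_ge0.
  apply: le_trans (sqr_le_powR _); last by rewrite y0 y1.
  rewrite -[leLHS]real_normK ?num_real// lerXn2r ?nnegrE//.
  rewrite /y normrM [`|A^-1|](ger0_norm Ai0) ler_wpM2r//.
  by case: b; rewrite ?ler_Re_cmod ?ler_Im_cmod.
have [eps epsP] := sign_choice a1; exists eps => z z1.
pose c := homog_part m (fun S => (sign R (eps S))%:C%C).
set l := 2 * ln _ + 1 in epsP.
have grid_bound p : good p -> cmod (tetra c (grid p)) <= A * (2 * l).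
  move=> gp; have E b : \sum_(S : {set 'I_n}) sign R (eps S) * a (p, b) S =
      (if b then complex.Re (tetra c (grid p)) else complex.Im (tetra c (grid p))) / A.
    have -> : tetra c (grid p) =
        \sum_(S : {set 'I_n} | #|S| == m) (sign R (eps S))%:C%C * monom S (grid p).
      rewrite [RHS]big_mkcond; apply: eq_bigr => S _; rewrite /c /homog_part.
      by case: ifP => //; rewrite mul0r.
    rewrite Re_sum Im_sum; case: b.
      rewrite mulr_suml [RHS]big_mkcond; apply: eq_bigr => S _; rewrite /a gp /=.
      case: ifP => _; rewrite ?mulr0// mulrA; congr (_ / _).
      by case: (monom _ _) => u v /=; rewrite mul0r subr0.
    rewrite mulr_suml [RHS]big_mkcond; apply: eq_bigr => S _; rewrite /a gp /=.
    case: ifP => _; rewrite ?mulr0// mulrA; congr (_ / _).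
    by case: (monom _ _) => u v /=; rewrite mul0r addr0.
  apply: le_trans (cmod_le_ReIm _) _.
  have := epsP (p, true); have := epsP (p, false); rewrite !E !normrM.
  rewrite [`|A^-1|](ger0_norm Ai0) !ler_pdivrMr//; lra.
have le_l : 2 * l <= n%:R ^+ 8.
  by rewrite /l card_prod card_ffun !card_prod !card_ord card_bool ln_grid_bound.
have z01 i : cmod (z i) <= 1.
  apply: powR_le1; first exact: cmod_ge0.
  apply: le_trans z1; rewrite (bigD1 i)//= lerDl sumr_ge0// => j _; exact: powR_ge0.
(* Rounding up strictly keeps the radii [rho i] positive, as [polydisc_max] demands; |z_i| <= 1
   gives k i <= n + 1, whence the index type ['I_n.+2]. *)
pose k (i : 'I_n) := (Num.truncn (n%:R * cmod (z i))).+1.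
have nz0 i : 0 <= n%:R * cmod (z i) by rewrite mulr_ge0 ?cmod_ge0.
have k_lt i : (k i < n.+2)%N.
  have /andP[lo _] := truncn_itv (nz0 i).
  rewrite /k !ltnS -(ler_nat R); apply: le_trans lo _.
  by rewrite ler_piMr.
pose rho i : R := (k i)%:R / n%:R.
have rho0 i : 0 < rho i by rewrite divr_gt0// ltr0n.
have z_rho i : cmod (z i) <= rho i.
  have /andP[_ up] := truncn_itv (nz0 i).
  by rewrite /rho ler_pdivlMr// mulrC ltW.
have rho_z i : rho i <= cmod (z i) + n%:R^-1.
  have /andP[lo _] := truncn_itv (nz0 i).
  rewrite /rho ler_pdivrMr// mulrDl mulVf ?gt_eqF// [cmod _ * _]mulrC.
  by rewrite /k -natr1 lerD2r.
apply: (@le_trans _ _ (A * (2 * l))); last by rewrite ler_wpM2l// ltW.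
apply: (polydisc_max rho0 _ z_rho) => eta.
pose p : {ffun 'I_n -> 'I_n.+2 * (bool * bool)} :=
  [ffun i => (Ordinal (k_lt i), eta i)].
have gE i : grid p i = (rho i)%:C%C * corner R (eta i) by rewrite /grid ffunE.
rewrite (_ : (fun i => _) = grid p); last by apply/funext => i; rewrite gE.
apply: grid_bound; rewrite /good.
have n_inv0 : 0 <= n%:R^-1 :> R by rewrite invr_ge0.
have n_inv : powR n%:R^-1 r <= n%:R^-1.
  apply: ge1r_powR; last by case/andP: r12.
  by rewrite invr_gt0 N0 invf_le1// ler1n (leq_trans _ n2).
apply: (@le_trans _ _ (\sum_i 16 * (powR (cmod (z i)) r + n%:R^-1))).
  apply: ler_sum => i _; apply: (@le_trans _ _ (powR (2 * rho i) r)).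
    apply: powR_mono; rewrite ?cmod_ge0// gE cmodM (cmodRge0 (ltW (rho0 i))) mulrC.
    by rewrite ler_wpM2r ?cmod_corner// ltW.
  have := powR_double (ltW (rho0 i)); have := powR_mono (ltW (rho0 i)) (rho_z i).
  have := powR_add (cmod_ge0 (z i)) n_inv0; lra.
rewrite -mulr_sumr big_split /= sumr_const card_ord -[_^-1 *+ n]mulr_natl mulfV ?gt_eqF//; lra.
Qed.

End SmallPolynomial.

(** Induction through (m + 1) C(n + 1, m + 1) = (n + 1) C(n, m), together with m (n + 1) <= (m + 1)
    n for m <= n. *)
Lemma expn_le_bin (n m : nat) : (m <= n)%N -> (n ^ m <= m ^ m * 'C(n, m))%N.
Proof.
elim: m n => [|m IH] [|n]//; rewrite ltnS => mn.
rewrite !expnS -mulnA mulnCA -mul_bin_diag mulnCA leq_pmul2l//.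
case: (posnP m) => [->|m0]; first by rewrite bin0.
rewrite -(@leq_pmul2l (m ^ m)) ?expn_gt0 ?m0// mulnCA mulnA [(m ^ m * _)%N]mulnC.
apply: (@leq_trans (m.+1 ^ m * n ^ m)); first by rewrite -!expnMn leq_exp2r//; nia.
by rewrite -!mulnA leq_mul2l IH ?orbT.
Qed.

(** * The upper bound for the Bohr radius *)

Section BohrUpperBound.
Variables (R : realType) (X : set (cseq R)) (nrm : cseq R -> R).
Hypothesis XS : symmetric_BSL X nrm.
Variables (n : nat) (r : R).
Hypotheses (n2 : (2 <= n)%N) (r12 : 1 <= r <= 2).
Implicit Types (z : 'I_n -> R[i]).

Let n0 : 0 < n%:R :> R. Proof. by rewrite ltr0n (leq_trans _ n2). Qed.
Let ri_ge0 : 0 <= r^-1.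
Proof. by case/andP: r12 => ? _; rewrite invr_ge0 (le_trans ler01). Qed.

Lemma id_norm_ub z : Xn_norm nrm z <= 1 ->
  powR (\sum_i powR (cmod (z i)) r) r^-1 <= id_norm nrm n r.
Proof.
move=> z1; apply: ub_le_sup; last by exists z.
(* The coordinate bounds |w_i| <= 1/|e_i| show that [id_norm] is a genuine supremum. *)
exists (powR (\sum_(i < n) powR (nrm (unit_seq R i))^-1 r) r^-1) => _ [w w1 <-].
apply: ge0_ler_powR; rewrite ?nnegrE ?sumr_ge0//; try by move=> *; apply: powR_ge0.
apply: ler_sum => i _; apply: (powR_mono r12); first exact: cmod_ge0.
rewrite -[leRHS]mul1r ler_pdivlMr ?(nrm_unit_gt0 XS)//.
by apply: le_trans w1; apply: (Xn_norm_coord XS).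
Qed.

Let nu := Xn_norm nrm (char_vec R [set: 'I_n]).

Let nu_gt0 : 0 < nu.
Proof.
have i0 : 'I_n := Ordinal (leq_trans (isT : 0 < 2)%N n2).
have := Xn_norm_coord XS (char_vec R [set: 'I_n]) i0.
rewrite /char_vec finset.in_setT cmod1 mul1r; apply: lt_le_trans.
exact: (nrm_unit_gt0 XS).
Qed.

(** The flat test vector, of norm 1/2 and so inside the open ball; all monomials of one degree have
    equal modulus at it. *)
Let z0 : 'I_n -> R[i] := fun i => ((2 * nu)^-1)%:C%C * char_vec R [set: 'I_n] i.

Let z0_norm : Xn_norm nrm z0 = 2^-1.
Proof.
rewrite /z0 (Xn_normZ XS) -/nu cmodRge0 ?invr_ge0 ?mulr_ge0// ?ltW//.
by rewrite invfM mulfVK// gt_eqF.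
Qed.

Let cmod_z0 i : cmod (z0 i) = (2 * nu)^-1.
Proof.
rewrite /z0 /char_vec finset.in_setT mulr1 cmodRge0//.
by rewrite invr_ge0 mulr_ge0// ltW.
Qed.

Lemma id_norm_gt0 : 0 < id_norm nrm n r.
Proof.
have z01 : Xn_norm nrm z0 <= 1 by rewrite z0_norm invf_le1// ler1n.
apply: lt_le_trans (id_norm_ub z01); apply: powR_gt0.
under eq_bigr do rewrite cmod_z0.
rewrite sumr_const card_ord pmulrn_lgt0 ?(leq_trans _ n2)//.
by rewrite powR_gt0// invr_gt0 mulr_gt0.
Qed.

Lemma ball_id_norm z : Xn_ball nrm z ->
  \sum_i powR (cmod ((id_norm nrm n r)^-1%:C%C * z i)) r <= 1.
Proof.
move=> Bz; set D := id_norm nrm n r.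
have D0 : 0 < D := id_norm_gt0.
have Di0 : 0 <= D^-1 by rewrite invr_ge0 ltW.
under eq_bigr do rewrite cmodM (cmodRge0 Di0) powRM ?cmod_ge0//.
rewrite -mulr_sumr -(powR_inv1 (ltW D0)) -powRrM mulN1r powRN mulrC.
rewrite ler_pdivrMr ?powR_gt0// mul1r.
have s0 : 0 <= \sum_i powR (cmod (z i)) r.
  by apply: sumr_ge0 => i _; apply: powR_ge0.
rewrite -(powRK r12 s0); apply: (powR_mono r12); first exact: powR_ge0.
exact: id_norm_ub (ltW Bz).
Qed.

(** Testing the random polynomial at [z0] bounds [(rho / (2 * nu)) ^+ m * 'C(n, m)]. As n <= e^m,
    the factor n^8 is at most e^(8m), so m-th roots leave only e^8. *)
Lemma bohr_ok_upper (m : nat) (rho : R) : (0 < m <= n)%N ->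
  (n%:R : R) <= expR m%:R -> 0 < rho -> bohr_ok nrm n rho ->
  rho <= 2 * nu * id_norm nrm n r * (m%:R / n%:R)
     * powR (32 * expR 1 / m%:R) r^-1 * expR 8.
Proof.
move=> /andP[m0 mn] nm rho0 ok; set D := id_norm nrm n r.
have D0 : 0 < D := id_norm_gt0.
have [eps epsP] := exists_small_polynomial r12 n2 m0.
set c := homog_part m _ in epsP; pose P := powR (32 * expR 1 / m%:R) r^-1.
have P0 : 0 <= P by apply: powR_ge0.
have up z : Xn_ball nrm z -> cmod (tetra c z) <= (D * P * expR 8) ^+ m.
  move=> Bz; have := epsP _ (ball_id_norm Bz).
  have Di0 : 0 <= D^-1 by rewrite invr_ge0 ltW.
  rewrite -/D tetra_homog_partZ exp_RC cmodM (cmodRge0 (exprn_ge0 m Di0)).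
  rewrite exprVn mulrC ler_pdivrMr ?exprn_gt0// => le1.
  apply: le_trans le1 _; rewrite /lr_const -/P !exprMn mulrC.
  have DP0 : 0 <= D ^+ m * P ^+ m by rewrite mulr_ge0 ?exprn_ge0// ltW.
  rewrite mulrA (ler_wpM2l DP0)//.
  rewrite -expRM_natl [m%:R * _]mulrC expRM_natl.
  by rewrite lerXn2r ?nnegrE ?expR_ge0// ltW.
have lo : (rho / (2 * nu)) ^+ m * 'C(n, m)%:R <= (D * P * expR 8) ^+ m.
  rewrite -lee_fin; have B0 : Xn_ball nrm z0.
    by rewrite /Xn_ball /= z0_norm invf_lt1// ltr1n.
  apply: le_trans; last first.
    apply: (@ge_ereal_sup _ [set (cmod (tetra c z))%:E | z in Xn_ball nrm (n:=n)]).
    by move=> _ [z Bz <-]; rewrite lee_fin; apply: up.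
  apply: le_trans (ok c); apply: ereal_sup_ubound.
  exists (fun i => rho%:C%C * z0 i); first by exists z0.
  congr (_%:E); rewrite -[n in 'C(n, _)]card_ord -card_draws -sum1_card.
  rewrite natr_sum mulr_sumr [RHS]big_mkcond; apply: eq_bigr => S _.
  rewrite inE /c /homog_part; case: ifP => Sm; last by rewrite mul0r cmod0.
  rewrite mulr1 cmodM cmodR /sign normrX normrN1 expr1n mul1r cmod_monom.
  rewrite (eq_bigr (fun=> rho / (2 * nu))) => [|i _].
    by rewrite prodr_const (eqP Sm).
  by rewrite cmodM cmod_z0 cmodRge0// ltW.
rewrite -(@ler_pXn2r _ m) ?nnegrE//; [|exact: ltW|]; last first.
  by rewrite !mulr_ge0 ?expR_ge0// ltW.
have binR : n%:R ^+ m <= m%:R ^+ m * 'C(n, m)%:R :> R.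
  by rewrite -!natrX -natrM ler_nat expn_le_bin.
have mR0 : 0 < m%:R :> R by rewrite ltr0n.
have nu2 : 0 < 2 * nu by rewrite mulr_gt0.
have -> : rho ^+ m = (2 * nu * (m%:R / n%:R)) ^+ m *
    ((rho / (2 * nu)) ^+ m * (n%:R / m%:R) ^+ m).
  rewrite -!exprMn; congr (_ ^+ m); field.
  by rewrite !gt_eqF.
have -> : 2 * nu * D * (m%:R / n%:R) * P * expR 8 =
   2 * nu * (m%:R / n%:R) * (D * P * expR 8) by ring.
have h1 : 0 <= (2 * nu * (m%:R / n%:R)) ^+ m.
  by rewrite exprn_ge0// mulr_ge0 ?divr_ge0// ltW.
have h2 : 0 <= (rho / (2 * nu)) ^+ m by rewrite exprn_ge0// divr_ge0// ltW.
rewrite [leRHS]exprMn (ler_wpM2l h1)//.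
apply: le_trans lo; rewrite (ler_wpM2l h2)//.
by rewrite expr_div_n ler_pdivrMr ?exprn_gt0// mulrC.
Qed.

Lemma ln2_ge : 2^-1 <= ln 2 :> R.
Proof.
rewrite -ler_expR lnK ?posrE//.
have e : (1 - 2^-1)^-1 = 2 :> R by field.
rewrite -[leRHS]e.
by apply: expR_le_inv; lra.
Qed.

Lemma bohr_radius_upper :
  bohr_radius nrm n <= (192 * expR 9) * powR (ln n%:R) (1 - r^-1)
     / phi_dual X nrm n * id_norm nrm n r.
Proof.
set D := id_norm nrm n r; have D0 : 0 < D := id_norm_gt0.
have ph0 : 0 < phi_dual X nrm n by apply: (phi_dual_gt0 XS); apply: leq_trans n2.
set q := 1 - r^-1; have ri1 : r^-1 <= 1.
  by case/andP: r12 => r1 _; rewrite invf_le1// (lt_le_trans ltr01).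
have q01 : 0 <= q <= 1 by rewrite /q subr_ge0 ri1 gerBl ri_ge0.
have ln_half : 2^-1 <= ln n%:R :> R.
  by apply: le_trans ln2_ge _; rewrite ler_ln ?posrE ?ler_nat.
set l : R := ln n%:R in ln_half *.
(* The least integer above ln n: hence n <= e^m, while ln n >= 1/2 gives m <= 3 ln n. *)
pose m := (Num.truncn l).+1.
have l0 : 0 <= l by lra.
have /andP[m_lo m_up] := truncn_itv l0.
have m_le : m%:R <= 3 * l by rewrite /m -natr1; lra.
have mn : (m <= n)%N.
  rewrite /m -(ltr_nat R); apply: le_lt_trans m_lo _.
  by rewrite -ltr_expR /l lnK ?posrE// (lt_le_trans _ (expR_ge1Dx _))// ltrDr.
have nm : (n%:R : R) <= expR m%:R.
  by rewrite -[n%:R]lnK ?posrE// ler_expR ltW.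
have mR0 : 0 < m%:R :> R by rewrite ltr0n.
set rhs := (X in _ <= X).
have rhs0 : 0 <= rhs.
  by rewrite /rhs !mulr_ge0 ?powR_ge0 ?invr_ge0 ?expR_ge0// ltW.
rewrite /bohr_radius; set A := [set _ | _].
have [->|/set0P A0] := eqVneq A set0; first by rewrite sup0.
apply: ge_sup => // rho [/andP[rho0 _] ok].
have mn' : (0 < m <= n)%N by rewrite mn.
apply: le_trans (bohr_ok_upper mn' nm rho0 ok) _; rewrite -/D.
have nu_phi : nu / n%:R <= (phi_dual X nrm n)^-1.
  rewrite ler_pdivrMr// mulrC ler_pdivlMr//.
  by have := Xn_norm_char_vec_phi_dual XS [set: 'I_n]; rewrite cardsT card_ord.
(* Here m * m^(-1/r) = m^q <= 3 l^q, and 96 = 32 * 3. With the factor 2 e^8 of [bohr_ok_upper] this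
   makes the constant 192 e^9. *)
have pow_m : m%:R * powR (32 * expR 1 / m%:R) r^-1 <= 96 * expR 1 * powR l q.
  have e1 : 1 <= expR 1 :> R by rewrite -expR0 ler_expR.
  rewrite powRM ?invr_ge0 ?mulr_ge0 ?expR_ge0//.
  have pw1 : powR (32 * expR 1) r^-1 <= 32 * expR 1 by apply: ler1_powR => //; lra.
  have -> : powR m%:R^-1 r^-1 = (powR m%:R r^-1)^-1.
    by rewrite -powR_inv1// -powRrM mulN1r powRN.
  have pw2 : m%:R / powR m%:R r^-1 <= 3 * powR l q.
    have -> : m%:R / powR m%:R r^-1 = powR m%:R q.
      by rewrite /q powRB ?powRr1// (gt_eqF mR0) implybT.
    apply: (@le_trans _ _ (powR (3 * l) q)).
      by apply: ge0_ler_powR; rewrite ?nnegrE//; [case/andP: q01|lra].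
    rewrite powRM// ler_wpM2r ?powR_ge0//; apply: ler1_powR; first by rewrite ler1n.
    by case/andP: q01.
  have -> : m%:R * (powR (32 * expR 1) r^-1 / powR m%:R r^-1) =
    powR (32 * expR 1) r^-1 * (m%:R / powR m%:R r^-1) by ring.
  have -> : 96 * expR 1 * powR l q = (32 * expR 1) * (3 * powR l q) by ring.
  by apply: ler_pM; rewrite ?divr_ge0 ?powR_ge0.
have -> : 2 * nu * D * (m%:R / n%:R) * powR (32 * expR 1 / m%:R) r^-1 * expR 8 =
  (2 * D * expR 8) * ((nu / n%:R) * (m%:R * powR (32 * expR 1 / m%:R) r^-1)) by ring.
have -> : rhs = (2 * D * expR 8) * ((phi_dual X nrm n)^-1 * (96 * expR 1 * powR l q)).
  rewrite /rhs (_ : 9 = 8 + 1 :> R); last by rewrite natr1.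
  by rewrite expRD; ring.
apply: ler_wpM2l; first by rewrite !mulr_ge0 ?expR_ge0// ltW.
by apply: ler_pM; rewrite ?divr_ge0 ?mulr_ge0 ?powR_ge0// ltW.
Qed.

End BohrUpperBound.

Theorem theorem2p32 (R : realType) (X : set (cseq R)) (nrm : cseq R -> R) :
  symmetric_BSL X nrm ->
  (exists C : R, 0 < C /\
     forall n : nat, (1 <= n)%N ->
       inf [set powR (phi_dual X nrm m.-1 / phi_dual X nrm n) (m.-1%:R / m%:R)
           | m in [set m : nat | (1 <= m <= n)%N]]
       <= C * bohr_radius nrm n)
  /\
  (forall r : R, 1 <= r <= 2 ->
     exists C : R, 0 < C /\
       forall n : nat, (2 <= n)%N ->
         bohr_radius nrm n
         <= C * powR (ln n%:R) (1 - r^-1) / phi_dual X nrm n * id_norm nrm n r).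
Proof.
move=> XS; split.
  exists (8 * expR 1); split; first by rewrite mulr_gt0 ?expR_gt0.
  by move=> n n1; apply: bohr_radius_lower.
move=> r r12; exists (192 * expR 9); split; first by rewrite mulr_gt0 ?expR_gt0.
by move=> n n2; apply: bohr_radius_upper.
Qed.
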